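(* If $G$ is a subdivision of a simple $3$-connected plane graph $R$, then $$\chi_c(G) \leq \max_{f\in F(G)}\{ \deg_G(f) -\deg_R(f')\} + t(G) + \chi_c(R),$$ where for each face $f$ of $G$, $f'$ is the face of $R$ corresponding to $f$. Moreover, the bound is tight: there exist such graphs for which equality holds.
   Context: Plane graphs may have multiple edges but no loops; a simple graph has no multiple edges. A subdivision of a graph is obtained by repeatedly replacing an edge $uv$ by a path $u,w,v$ through a new vertex $w$; the faces of $G$ are in natural one-to-one correspondence with the faces of $R$. $F(G)$ is the face set of $G$, and $\deg_G(f)$ is the number of vertices incident with the face $f$ in $G$. $t(G)$ denotes the number of vertices of a longest path in $G$ all of whose vertices have degree $2$ (and $t(G)=0$ if there is no vertex of degree 2). A cyclic coloring of a plane graph is a vertex coloring in which any two distinct vertices incident with a common face receive distinct colors; $\chi_c$ denotes the minimum number of colors in a cyclic coloring. *)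

(* Defs.v *)
From mathcomp Require Import all_boot all_fingroup.

Set Implicit Arguments.
Unset Strict Implicit.
Unset Printing Implicit Defensive.

(* A graph drawn on a closed oriented surface, encoded by its rotation system.
   A dart is an edge together with one of its two directions: [edge] reverses
   a dart and [node] sends a dart to the next one around its origin.  Multiple
   edges are allowed; isolated vertices are not represented. *)
Record cmap := CMap {
  dart : finType;
  edge : {perm dart};
  node : {perm dart};
  edgeK : involutive edge;
  edge_neq : forall x, edge x != x }.

(* [face x = node (edge x)], as perm products act from left to right. *)
Definition face_perm (G : cmap) : {perm dart G} := (edge G * node G)%g.

Definition vertex (G : cmap) : finType :=
  {v : {set dart G} | v \in porbits (node G)}.
Definition face (G : cmap) : finType :=
  {f : {set dart G} | f \in porbits (face_perm G)}.

Section Notions.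
Variable G : cmap.

Definition loopless :=
  forall x : dart G, edge G x \notin porbit (node G) x.

Definition connected :=
  forall x y : dart G,
    connect [rel a b | (b == edge G a) || (b == node G a)] x y.

(* Euler's formula V + F = E + 2: genus 0, for a connected map. *)
Definition planar :=
  #|{: vertex G}| + #|{: face G}| = #|porbits (edge G)| + 2.

Definition plane_graph := [/\ loopless, connected & planar].

(* Two darts with the same origin and the same target coincide. *)
Definition simple :=
  forall x y : dart G, y \in porbit (node G) x ->
    edge G y \in porbit (node G) (edge G x) -> x = y.

Definition adj : rel (vertex G) :=
  fun v w => [exists x in val v, edge G x \in val w].

Definition three_connected :=
  3 < #|{: vertex G}| /\
  forall S : {set vertex G}, #|S| < 3 ->
    forall v w : vertex G, v \notin S -> w \notin S ->
      connect [rel a b | [&& adj a b, a \notin S & b \notin S]] v w.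

Definition vdeg (v : vertex G) := #|val v|.

(* A face is the set of darts having it on a fixed side; the vertices incident
   with it are the origins of these darts. *)
Definition incident (v : vertex G) (f : {set dart G}) :=
  [exists x in val v, x \in f].

Definition fdeg (f : {set dart G}) := #|[set v : vertex G | incident v f]|.

Definition deg2_path (s : seq (vertex G)) :=
  [&& uniq s, sorted adj s & all (fun v => vdeg v == 2) s].

Definition longest_deg2_path :=
  \max_(n < #|{: vertex G}|.+1 |
        [exists s : n.-tuple (vertex G), deg2_path s]) (n : nat).

Definition cofacial (v w : vertex G) :=
  [exists f : face G, incident v (val f) && incident w (val f)].

Definition cyclic_coloring k (c : {ffun vertex G -> 'I_k}) :=
  [forall v, forall w, (v != w) && cofacial v w ==> (c v != c w)].

Definition cyclically_colorable k :=
  [exists c : {ffun vertex G -> 'I_k}, cyclic_coloring c].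

Lemma cyclically_colorable_ex : exists k, cyclically_colorable k.
Proof.
exists #|{: vertex G}|; apply/existsP; exists [ffun v => enum_rank v].
apply/forallP=> v; apply/forallP=> w; apply/implyP=> /andP[vw _].
by rewrite !ffunE (inj_eq enum_rank_inj).
Qed.

Definition chi_c := ex_minn cyclically_colorable_ex.

End Notions.

(* The edge carrying the darts x and edge x is replaced by a path through a
   new vertex, whose two darts are a (facing back along x) and b (facing
   forward along x); i embeds the old darts, keeping their origins. *)
Record elementary_subdivision (G G' : cmap) (i : dart G -> dart G')
    (x : dart G) (a b : dart G') : Prop := ElementarySubdivision {
  esub_inj : injective i;
  esub_neq : a != b;
  esub_new_a : forall y, i y != a;
  esub_new_b : forall y, i y != b;
  esub_cover : forall z, [\/ z = a, z = b | exists y, z = i y];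
  esub_edge_x : edge G' (i x) = a;
  esub_edge_b : edge G' b = i (edge G x);
  esub_edge : forall y, y != x -> y != edge G x ->
    edge G' (i y) = i (edge G y);
  esub_node_a : node G' a = b;
  esub_node_b : node G' b = a;
  esub_node : forall y, node G' (i y) = i (node G y) }.

(* [subdivision R G h]: G is a subdivision of R, where h sends a dart of R to
   the first dart of the directed path of G that replaces it. *)
Inductive subdivision (R : cmap) : forall G : cmap, (dart R -> dart G) -> Prop :=
| subdivision_refl : subdivision (fun x => x)
| subdivision_step (G G' : cmap) (h : dart R -> dart G) (i : dart G -> dart G')
    (x : dart G) (a b : dart G') :
    subdivision h -> elementary_subdivision i x a b ->
    subdivision (fun y => i (h y)).

(* The face of R corresponding to a face f of G consists of the darts of R
   whose image lies on f; see [base_face_face] and [base_face_bij]. *)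
Definition base_face (R G : cmap) (h : dart R -> dart G) (f : {set dart G}) :
  {set dart R} := h @^-1: f.

Section Elementary.
Variables (G G' : cmap) (i : dart G -> dart G') (x : dart G) (a b : dart G').
Hypothesis sub : elementary_subdivision i x a b.

Lemma esub_face_step y :
  i (face_perm G y) \in porbit (face_perm G') (i y).
Proof.
have fE H z : face_perm H z = node H (edge H z) by rewrite permM.
rewrite fE; have [->|yx] := eqVneq y x.
  have -> : i (node G (edge G x)) = (face_perm G' ^+ 2)%g (i x).
    by rewrite expgS expg1 permM !fE (esub_edge_x sub) (esub_node_a sub)
               (esub_edge_b sub) (esub_node sub).
  exact: mem_porbit.
have [->|yex] := eqVneq y (edge G x); last first.
  rewrite -(esub_node sub) -(esub_edge sub yx yex) -fE.
  by have := mem_porbit (face_perm G') 1 (i y); rewrite expg1.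
have eb : edge G' (i (edge G x)) = b by rewrite -(esub_edge_b sub) edgeK.
have ea : edge G' a = i x by rewrite -(esub_edge_x sub) edgeK.
have -> : i (node G (edge G (edge G x))) =
          (face_perm G' ^+ 2)%g (i (edge G x)).
  by rewrite expgS expg1 permM !fE eb (esub_node_b sub) ea (esub_node sub)
             edgeK.
exact: mem_porbit.
Qed.

Lemma esub_face y z :
  (i z \in porbit (face_perm G') (i y)) = (z \in porbit (face_perm G) y).
Proof.
apply/idP/idP; last first.
  move=> /porbitP[n ->]; elim: n => [|n IHn].
    by rewrite expg0 perm1 porbit_id.
  rewrite expgSr permM; move: IHn; rewrite -eq_porbit_mem => /eqP <-.
  exact: esub_face_step.
have fE H u : face_perm H u = node H (edge H u) by rewrite permM.
move=> /porbitP[n].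
suff: exists2 y', y' \in porbit (face_perm G) y &
    [\/ (face_perm G' ^+ n)%g (i y) = i y',
        (face_perm G' ^+ n)%g (i y) = b /\ y' = x |
        (face_perm G' ^+ n)%g (i y) = a /\ y' = edge G x].
  move=> [y' yy' [->|[-> _]|[-> _]]].
  - by move/(esub_inj sub) ->.
  - by move=> e; have := esub_new_b sub z; rewrite e eqxx.
  - by move=> e; have := esub_new_a sub z; rewrite e eqxx.
have next u : u \in porbit (face_perm G) y ->
    face_perm G u \in porbit (face_perm G) y.
  rewrite -eq_porbit_mem => /eqP <-.
  by have := mem_porbit (face_perm G) 1 u; rewrite expg1.
have eb : edge G' (i (edge G x)) = b by rewrite -(esub_edge_b sub) edgeK.
have ea : edge G' a = i x by rewrite -(esub_edge_x sub) edgeK.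
elim: n => [|n [y' yy' H]].
  by exists y; rewrite ?porbit_id // expg0 perm1; constructor 1.
rewrite expgSr permM; case: H => [->|[-> y'E]|[-> y'E]].
- have [y'x|y'x] := eqVneq y' x.
    exists x; first by rewrite -y'x.
    by rewrite y'x fE (esub_edge_x sub) (esub_node_a sub); constructor 2.
  have [y'e|y'e] := eqVneq y' (edge G x).
    exists (edge G x); first by rewrite -y'e.
    by rewrite y'e fE eb (esub_node_b sub); constructor 3.
  exists (face_perm G y'); first exact: next.
  by rewrite !fE (esub_edge sub) // (esub_node sub); constructor 1.
- exists (face_perm G y'); first exact: next.
  by rewrite y'E !fE (esub_edge_b sub) (esub_node sub); constructor 1.
- exists (face_perm G y'); first exact: next.
  by rewrite y'E !fE ea (esub_node sub) edgeK; constructor 1.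
Qed.

Lemma esub_face_surj z : exists y, i y \in porbit (face_perm G') z.
Proof.
have fE H u : face_perm H u = node H (edge H u) by rewrite permM.
have ea : edge G' a = i x by rewrite -(esub_edge_x sub) edgeK.
have m1 u : face_perm G' u \in porbit (face_perm G') u.
  by have := mem_porbit (face_perm G') 1 u; rewrite expg1.
case: (esub_cover sub z) => [->|->|[y ->]].
- by exists (node G x); rewrite -(esub_node sub) -ea -fE.
- by exists (node G (edge G x)); rewrite -(esub_node sub) -(esub_edge_b sub) -fE.
- by exists y; rewrite porbit_id.
Qed.

Lemma esub_vertex y : porbit (node G') (i y) = i @: porbit (node G) y.
Proof.
have nE n : (node G' ^+ n)%g (i y) = i ((node G ^+ n)%g y).
  elim: n => [|n IHn]; first by rewrite !expg0 !perm1.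
  by rewrite !expgSr !permM IHn (esub_node sub).
apply/setP=> z; apply/porbitP/imsetP.
  by move=> [n ->]; exists ((node G ^+ n)%g y); rewrite ?nE ?mem_porbit.
by move=> [u /porbitP[n ->] ->]; exists n.
Qed.

End Elementary.

Section Subdivision.
Variables (R G : cmap) (h : dart R -> dart G).
Hypothesis sub : subdivision h.

Lemma subdivision_inj : injective h.
Proof.
by elim: sub => // G1 G2 h1 i x a b _ IH es y z /(esub_inj es)/IH.
Qed.

Lemma subdivision_face y z :
  (h z \in porbit (face_perm G) (h y)) = (z \in porbit (face_perm R) y).
Proof.
by elim: sub => // G1 G2 h1 i x a b _ IH es; rewrite (esub_face es) IH.
Qed.

Lemma subdivision_face_surj z : exists y, h y \in porbit (face_perm G) z.
Proof.
elim: sub z => [z|G1 G2 h1 i x a b _ IH es z]; first by exists z; rewrite porbit_id.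
have [u uz] := esub_face_surj es z; have [y yu] := IH u.
by exists y; move: uz; rewrite -eq_porbit_mem => /eqP <-; rewrite (esub_face es).
Qed.

Lemma subdivision_vertex y : porbit (node G) (h y) = h @: porbit (node R) y.
Proof.
elim: sub => [|G1 G2 h1 i x a b _ IH es]; first by rewrite imset_id.
by rewrite (esub_vertex es) IH -imset_comp.
Qed.

Lemma base_face_face (f : face G) :
  base_face h (val f) \in porbits (face_perm R).
Proof.
case: f => f /= /imsetP[z _ ->]; have [y yz] := subdivision_face_surj z.
move: yz; rewrite -eq_porbit_mem => /eqP <-.
apply/imsetP; exists y => //; apply/setP=> u.
by rewrite inE subdivision_face.
Qed.

Lemma base_face_bij :
  bijective (fun f : face G => Sub (base_face h (val f)) (base_face_face f)
                               : face R).
Proof.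
apply: inj_card_bij.
  move=> [f fP] [g gP] /(congr1 val) /=; move/imsetP: (fP) => [z _ fE].
  have [y] := subdivision_face_surj z; rewrite -fE => yf fg.
  have yg : h y \in g.
    by move/setP/(_ y): fg; rewrite !inE yf => <-.
  apply: val_inj => /=; move/imsetP: gP yg => [w _ ->].
  move: yf; rewrite fE -!eq_porbit_mem => /eqP <- /eqP <- //.
have lift_in (f : face R) : exists g : face G, base_face h (val g) == val f.
  case: f => f /= /imsetP[y _ ->].
  have gP : porbit (face_perm G) (h y) \in porbits (face_perm G).
    exact: imset_f.
  pose g : face G := Sub (porbit (face_perm G) (h y)) gP.
  exists g; apply/eqP/setP=> u /=; rewrite inE.
  exact: subdivision_face.
pose g f := xchoose (lift_in f).
apply: (@leq_card _ _ g) => f1 f2 /(congr1 (fun u => base_face h (val u))).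
by rewrite !(eqP (xchooseP (lift_in _))) => /val_inj.
Qed.

Lemma leq_fdeg_base_face (f : {set dart G}) : fdeg (base_face h f) <= fdeg f.
Proof.
have up (v : vertex R) : h @: val v \in porbits (node G).
  case: v => v /= /imsetP[y _ ->]; rewrite -subdivision_vertex.
  exact: imset_f.
pose g (v : vertex R) : vertex G := Sub (h @: val v) (up v).
have g_inj : injective g.
  by move=> v w /(congr1 val)/=/(imset_inj subdivision_inj)/val_inj.
rewrite /fdeg -(card_imset _ g_inj); apply: subset_leq_card.
apply/subsetP=> _ /imsetP[v vf ->]; move: vf; rewrite !inE.
move=> /existsP[y /andP[yv yf]]; apply/existsP; exists (h y).
by rewrite /= imset_f //=; move: yf; rewrite inE.
Qed.

End Subdivision.

(* Main.v *)
(** The vertices that G adds to R are the edges of a multigraph whose vertices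
    are the faces of G, two of them being cofacial exactly when they are adjacent
    edges.  The face f has degree deg_G(f) - deg_R(f') in it.  Two faces of a
    simple 3-connected plane graph share at most one edge, so parallel edges come
    from a single edge of R, whose new vertices form a path of vertices of degree
    2: multiplicities are at most t(G).  By Vizing's theorem for multigraphs,
    max (deg_G(f) - deg_R(f')) + t(G) colors suffice for the new vertices, and the
    remaining ones keep a cyclic coloring of R.

    That two faces share at most one edge follows from Euler's formula: deleting
    two common edges would leave V - E + F = 4, so the graph would have a cut of
    two edges.

    Subdividing the three edges of K4 at one vertex gives equality: the seven
    vertices are pairwise cofacial, and 7 = 2 + 1 + 4. *)

Require Import Defs.
From mathcomp Require Import all_boot all_fingroup zify.

Set Implicit Arguments.
Unset Strict Implicit.
Unset Printing Implicit Defensive.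

(** * Vizing's theorem for multigraphs *)

Section TwoInvolutions.
Variables (T : finType) (A B : T -> T).
Hypotheses (AK : involutive A) (BK : involutive B).
Variable x : T.
Hypothesis Ax : A x = x.

Let tau v := B (A v).

Lemma dihedral_inj : injective tau.
Proof. exact: inj_comp (inv_inj BK) (inv_inj AK). Qed.

(** [A] conjugates [tau] to its inverse, as in a dihedral group. *)
Lemma dihedral_iterA n v : iter n tau (A (iter n tau v)) = A v.
Proof.
elim: n v => //= n IHn v; rewrite -iterS iterSr /tau AK BK.
by rewrite -/tau IHn.
Qed.

(** Since [A] fixes [x], it sends tau^n x to tau^(-n) x, which is in the same orbit. *)
Lemma dihedral_orbitA v : fconnect tau x v -> fconnect tau x (A v).
Proof.
move=> /iter_findex <-; rewrite (fconnect_sym dihedral_inj).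
by rewrite -[X in fconnect _ _ X]Ax -(dihedral_iterA (findex tau x v) x) fconnect_iter.
Qed.

Lemma dihedral_orbitB v : fconnect tau x v -> fconnect tau x (B v).
Proof.
move=> xv; have -> : B v = tau (A v) by rewrite /tau AK.
exact: connect_trans (dihedral_orbitA xv) (fconnect1 _ _).
Qed.

Lemma iter_period n m : iter n tau x = x -> iter (m * n) tau x = x.
Proof. by move=> nx; elim: m => // m IHm; rewrite mulSn iterD IHm. Qed.

(* The points fixed by B are tau^(n+1) x with tau^(2n+1) x = x, so the period
   of x is odd and determines n modulo the period. *)
Lemma dihedral_fixed_uniq y z :
  fconnect tau x y -> fconnect tau x z -> x != y -> x != z ->
  B y = y -> B z = z -> y = z.
Proof.
have odd_period u : fconnect tau x u -> x != u -> B u = u ->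
    exists2 n, u = iter n.+1 tau x & iter n.*2.+1 tau x = x.
  move=> /iter_findex; case: (findex tau x u) => [<-|n <-]; first by rewrite eqxx.
  move=> _ Bu; exists n => //; rewrite -addnn -addnS iterD -Bu iterS.
  by rewrite /tau BK -/tau dihedral_iterA.
move=> xy xz nxy nxz By Bz.
have [n yE nx] := odd_period y xy nxy By.
have [m zE mx] := odd_period z xz nxz Bz.
rewrite yE zE; clear - nx mx; rewrite !iterS; congr tau.
wlog nm : n m nx mx / n <= m.
  by move=> W; case/orP: (leq_total n m) => ?; [|symmetry]; apply: W.
have [k mE] : exists k, m = k + n by exists (m - n); rewrite subnK.
rewrite {}mE {nm} in mx *; rewrite iterD.
have k2 : iter k.*2 tau x = x by move: mx; rewrite doubleD -addnS iterD nx.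
have kx : iter k tau x = x.
  (* Both 2k and 2n+1 are periods, and the second is odd: (n+1)*2k = k + k*(2n+1) makes k a
     period. *)
  have := iter_period n.+1 k2.
  have -> : n.+1 * k.*2 = k + k * n.*2.+1 by lia.
  by rewrite iterD (iter_period k nx).
by rewrite -iterD addnC iterD kx.
Qed.

End TwoInvolutions.

(** * Partial edge colorings of multigraphs and Vizing fans *)

Section Vizing.
Variables (V E : finType) (ends : E -> {set V}).
Hypothesis ends2 : forall e, #|ends e| = 2.

Definition opp (e : E) (v : V) := odflt v [pick w in ends e :\ v].

Lemma opp_ends e v : v \in ends e -> ends e = [set v; opp e v] /\ opp e v != v.
Proof.
move=> ve; have /cards1P[w wE] : #|ends e :\ v| == 1.
  by have := cardsD1 v (ends e); rewrite ve ends2 => /eqP; rewrite eqSS eq_sym.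
have -> : opp e v = w.
  rewrite /opp; case: pickP => [u|/(_ w)] /=; rewrite wE inE ?eqxx //.
  by move/eqP.
have /setD1P[wv _] : w \in ends e :\ v by rewrite wE set11.
by split; rewrite // -(setD1K ve) wE.
Qed.

Lemma mem_opp e v : v \in ends e -> opp e v \in ends e.
Proof. by move=> /opp_ends[-> _]; rewrite !inE eqxx orbT. Qed.

Lemma opp_neq e v : v \in ends e -> opp e v != v.
Proof. by case/opp_ends. Qed.

Lemma mem_ends e v w : v \in ends e -> w \in ends e -> w = v \/ w = opp e v.
Proof. by move=> /opp_ends[-> _]; rewrite !inE => /orP[]/eqP; [left|right]. Qed.

Lemma oppK e v : v \in ends e -> opp e (opp e v) = v.
Proof.
move=> ve; have := mem_opp (mem_opp ve); have := opp_neq (mem_opp ve).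
by move=> /eqP n /(mem_ends ve)[].
Qed.

Variable k : nat.
Implicit Type c : E -> option 'I_k.

(** [None] marks an uncolored edge, so two edges with a common end may agree only by both being
    uncolored. *)
Definition proper_partial c := forall e f v,
  e != f -> v \in ends e -> v \in ends f -> c e = c f -> c e = None.

Definition missing c v : {set 'I_k} :=
  [set a | [forall e, (v \in ends e) ==> (c e != Some a)]].

Lemma missingP c v a :
  reflect (forall e, v \in ends e -> c e <> Some a) (a \in missing c v).
Proof.
rewrite inE; apply: (iffP forallP) => H e; first by move=> ve; have := H e; rewrite ve => /eqP.
by apply/implyP=> /H/eqP.
Qed.

Lemma proper_inj c e f v a : proper_partial c ->
  v \in ends e -> v \in ends f -> c e = Some a -> c f = Some a -> e = f.
Proof.
move=> pc ve vf ce cf; apply/eqP/contraT => ef.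
by have := pc e f v ef ve vf; rewrite ce cf => /(_ erefl).
Qed.

(** Only the set of colored edges has to grow: shifting a fan or swapping Kempe chains changes the
    colors of edges already colored. *)
Definition extends c c' e0 := forall e, c' e = None -> c e = None /\ e != e0.

(** One step of a Vizing fan at [x]: the color of [f] is free at the far end of [e], so an uncolored
    [e] at [x] can take it over from [f]. *)
Definition fan_step c x (e f : E) :=
  (x \in ends f) && (if c f is Some a then a \in missing c (opp e x) else false).

(** Every edge of the fan takes the color of its successor, and the last one takes [a], which is
    free at both of its ends. The induction moves the uncolored edge one place along the fan. *)
Lemma fan_shift (p : seq E) c e0 x a : proper_partial c ->
  c e0 = None -> x \in ends e0 -> path (fan_step c x) e0 p -> uniq (e0 :: p) ->
  a \in missing c x -> a \in missing c (opp (last e0 p) x) ->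
  exists2 c', proper_partial c' & extends c c' e0.
Proof.
elim: p c e0 => [|f p IHp] c e0 pc c0 xe0.
  move=> _ _ /missingP ax /missingP ay.
  have new e v : e != e0 -> v \in ends e -> v \in ends e0 -> c e <> Some a.
    by move=> _ ve /(mem_ends xe0)[] vE; subst v; [apply: ax | apply: ay].
  exists (fun e => if e == e0 then Some a else c e); last first.
    by move=> e; case: eqP.
  move=> e g v eg ve vg /=; case: eqP => [eE|/eqP e1]; case: eqP => [gE|/eqP g1].
  - by rewrite eE gE eqxx in eg.
  - by subst e => E1; case: (new g v g1 vg ve).
  - by subst g => E1; case: (new e v e1 ve vg).
  - exact: (pc e g v).
move=> /= /andP[/andP[xf]]; case cf: (c f) => [b|] // bm pp.
rewrite inE negb_or => /andP[/andP[e0f e0p]] /andP[fp up] ax ay.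
pose c1 e := if e == e0 then Some b else if e == f then None else c e.
have c1old e : e != e0 -> e != f -> c1 e = c e by rewrite /c1 => /negPf -> /negPf ->.
have c1f : c1 f = None by rewrite /c1 eq_sym (negPf e0f) eqxx.
have c10 : c1 e0 = Some b by rewrite /c1 eqxx.
(* Besides [f], no edge meeting [e0] carries [b]: at [x] by properness, at the far end because [b]
   is missing there. *)
have new e v : e != f -> v \in ends e -> v \in ends e0 -> c e <> Some b.
  move=> ef ve /(mem_ends xe0)[] vE; subst v.
    by move=> ce; move: ef; rewrite (proper_inj pc ve xf ce cf) eqxx.
  by move/missingP: bm; apply.
have pc1 : proper_partial c1.
  move=> e g v eg ve vg.
  have [eE|ne0] := eqVneq e e0.
    subst e; rewrite c10; have [->|gf] := eqVneq g f; first by rewrite c1f.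
    have g0 : g != e0 by rewrite eq_sym.
    by rewrite c1old // => E1; case: (new g v gf vg ve).
  have [->|nef] := eqVneq e f; first by rewrite c1f.
  rewrite (c1old e) //; have [gE|ng0] := eqVneq g e0.
    by subst g; rewrite c10 => E1; case: (new e v nef ve vg).
  have [->|ngf] := eqVneq g f; first by rewrite c1f.
  by rewrite (c1old g) //; apply: (pc e g v).
have miss1 v d : d != b -> d \in missing c v -> d \in missing c1 v.
  move=> db /missingP dm; apply/missingP=> e ve; rewrite /c1.
  case: eqP => _; first by move=> [bd]; rewrite bd eqxx in db.
  by case: eqP => // _; apply: dm.
(* The rest of the fan avoids [e0] and [f], so its colors are unchanged, and none of them is [b],
   which only [f] carries at [x]. *)
have pp1 : path (fan_step c1 x) f p.
  have pa : all (fun g => (g != e0) && (g != f)) p.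
    apply/allP=> g gp; apply/andP; split.
      by apply: contraNneq e0p => <-.
    by apply: contraNneq fp => <-.
  suff gen q f' : all (fun g => (g != e0) && (g != f)) q ->
      path (fan_step c x) f' q -> path (fan_step c1 x) f' q by apply: gen.
  elim: q f' => //= g q IHq f' /andP[/andP[g0 gf] qa] /andP[st pq].
  rewrite IHq // andbT; move: st; rewrite /fan_step c1old //.
  case/andP=> xg; rewrite xg /=; case cg: (c g) => [d|] //; apply: miss1.
  apply: contraNneq gf => db; rewrite db in cg.
  by rewrite (proper_inj pc xg xf cg cf).
have ab : a != b.
  by apply: contraTneq ax => ->; apply/missingP=> /(_ f xf).
have [|c' pc' ec'] := IHp c1 f pc1 c1f xf pp1 _ (miss1 _ _ ab ax) (miss1 _ _ ab ay).
  by rewrite /= fp.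
exists c' => // e /ec'[c1e ef].
have e0' : e != e0 by apply: contraPneq c1e => ->; rewrite c10.
by split=> //; rewrite -c1old.
Qed.

(** * Kempe chains *)

Definition color_nbr c a v :=
  if [pick e | (v \in ends e) && (c e == Some a)] is Some e then opp e v else v.

Lemma color_nbr_edge c a e v : proper_partial c ->
  v \in ends e -> c e = Some a -> color_nbr c a v = opp e v.
Proof.
move=> pc ve ce; rewrite /color_nbr; case: pickP => [f /andP[vf /eqP cf]|/(_ e)].
  by rewrite (proper_inj pc vf ve cf ce).
by rewrite ve ce eqxx.
Qed.

Lemma color_nbr_missing c a v : a \in missing c v -> color_nbr c a v = v.
Proof.
move=> /missingP am; rewrite /color_nbr; case: pickP => // e /andP[ve /eqP ce].
by case: (am e).
Qed.

(** A Kempe chain thus becomes an orbit of the product of two involutions, and its ends are fixed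
    points of one of them. *)
Lemma color_nbrK c a : proper_partial c -> involutive (color_nbr c a).
Proof.
move=> pc v; rewrite {2}/color_nbr; case: pickP => [e /andP[ve /eqP ce]|none].
  by rewrite (color_nbr_edge pc (mem_opp ve) ce) oppK.
apply/color_nbr_missing/missingP=> e ve ce; have := none e.
by rewrite ve ce eqxx.
Qed.

(** The swap takes place away from [X], on all other chains at once: with [X] the chain of the
    center of a fan, the edges of the fan keep their colors. *)
Definition kempe_swap c a b (X : {set V}) e :=
  if [exists v in X, v \in ends e] then c e else omap (tperm a b) (c e).

Section Swap.
Variables (c : E -> option 'I_k) (a b : 'I_k) (X : {set V}).
Hypothesis pc : proper_partial c.
Hypothesis XA : forall v, v \in X -> color_nbr c a v \in X.
Hypothesis XB : forall v, v \in X -> color_nbr c b v \in X.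

Let swap := kempe_swap c a b X.

Lemma kempe_swap_in e v : v \in X -> v \in ends e -> swap e = c e.
Proof. by move=> vX ve; rewrite /swap /kempe_swap ifT //; apply/existsP; exists v; rewrite vX. Qed.

Lemma kempe_swap_other e d : d != a -> d != b -> (swap e == Some d) = (c e == Some d).
Proof.
move=> da db; rewrite /swap /kempe_swap; case: ifP => // _.
case: (c e) => //= d'.
rewrite (inj_eq Some_inj) (inj_eq Some_inj) -{1}(@tpermD _ a b d) 1?eq_sym //.
by rewrite (inj_eq perm_inj).
Qed.

(** An edge of color [a] or [b] with one end in [X] has both ends there, as [X] is closed. So an
    edge leaving [X] has another color or none, and the transposition does not change it. *)
Lemma kempe_swap_notin e v : v \in ends e -> v \notin X ->
  swap e = omap (tperm a b) (c e).
Proof.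
move=> ve vX; rewrite /swap /kempe_swap; case: ifP => // /existsP[w /andP[wX we]].
have vE : v = opp e w.
  by case: (mem_ends we ve) => // vw; rewrite vw wX in vX.
case ce: (c e) => [d|] //=; rewrite tpermD //.
  apply: contraNneq vX => ad; subst d.
  by rewrite vE -(color_nbr_edge pc we ce) XA.
apply: contraNneq vX => bd; subst d.
by rewrite vE -(color_nbr_edge pc we ce) XB.
Qed.

(** At a vertex of [X] all edges keep their colors; at any other vertex all undergo the same
    permutation. *)
Lemma kempe_swap_proper : proper_partial swap.
Proof.
move=> e f v ef ve vf; have [vX|vX] := boolP (v \in X).
  by rewrite (kempe_swap_in vX ve) (kempe_swap_in vX vf); exact: (pc ef ve vf).
rewrite (kempe_swap_notin ve vX) (kempe_swap_notin vf vX) => E1.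
have ce : c e = None.
  apply: (pc ef ve vf); move: E1.
  by case: (c e) (c f) => [d|] [d'|] //= [/perm_inj ->].
by rewrite ce.
Qed.

Lemma kempe_swap_missing v : v \notin X -> b \in missing c v -> a \in missing swap v.
Proof.
move=> vX /missingP bm; apply/missingP=> e ve; rewrite (kempe_swap_notin ve vX).
case ce: (c e) => [d|] //= [dE]; apply: (bm e ve).
by rewrite ce -[d](tpermK a b) dE tpermL.
Qed.

Lemma kempe_swap_missing_in v d : v \in X -> d \in missing c v -> d \in missing swap v.
Proof.
by move=> vX /missingP dm; apply/missingP=> e ve; rewrite (kempe_swap_in vX ve); apply: dm.
Qed.

Lemma kempe_swap_missing_other v d : d != a -> d != b ->
  d \in missing c v -> d \in missing swap v.
Proof.
move=> da db /missingP dm; apply/missingP=> e ve /eqP.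
by rewrite kempe_swap_other // => /eqP; apply: dm.
Qed.

Lemma kempe_swap_None e : swap e = None -> c e = None.
Proof. by rewrite /swap /kempe_swap; case: ifP => // _; case: (c e). Qed.

End Swap.

(** * Fans meeting a Kempe chain *)

Lemma first_on_path (e : rel E) (Q : pred E) e0 p :
  path e e0 p -> uniq (e0 :: p) -> Q (last e0 p) ->
  exists q, [/\ path e e0 q, uniq (e0 :: q), Q (last e0 q),
                {in belast e0 q, forall g, ~~ Q g} & {subset q <= p}].
Proof.
elim: p e0 => [|f p IHp] e0 /=; first by exists [::].
case/andP=> ef pp /andP[e0p up] Ql.
have [Q0|nQ0] := boolP (Q e0); first by exists [::].
have [q [pq uq Qq nQ sqp]] := IHp f pp up Ql.
have sfq : {subset f :: q <= f :: p}.
  by move=> g; rewrite !inE => /orP[->//|/sqp ->]; rewrite orbT.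
exists (f :: q); split=> //=; first by rewrite ef.
- by move: uq => /= ->; rewrite andbT; apply: contra e0p; apply: sfq.
- by move=> g; rewrite inE => /orP[/eqP ->|/nQ].
Qed.

Lemma fan_ends c x e0 f : x \in ends e0 -> connect (fan_step c x) e0 f -> x \in ends f.
Proof.
move=> xe0 /connectP[p]; elim/last_ind: p => [|p g _]; first by move=> _ ->.
by rewrite rcons_path last_rcons => /andP[_ /andP[xg _]] ->.
Qed.

Lemma connect_uniq (e : rel E) e0 f : connect e e0 f ->
  exists p, [/\ path e e0 p, uniq (e0 :: p) & f = last e0 p].
Proof.
by move=> /connectP[p pp ->]; case/shortenP: pp => q pq uq _; exists q.
Qed.

(* If the ab-Kempe chain of x avoided opp f x, swapping a and b off that chain
   would free a at opp f x as well as at x, and the fan could be shifted. *)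
Lemma fan_missing_uniq c e0 x a b f g : proper_partial c ->
  c e0 = None -> x \in ends e0 ->
  (~ exists2 c', proper_partial c' & extends c c' e0) ->
  connect (fan_step c x) e0 f -> connect (fan_step c x) e0 g ->
  a \in missing c x -> b \in missing c (opp f x) -> b \in missing c (opp g x) ->
  opp f x = opp g x.
Proof.
move=> pc c0 xe0 stuck ef eg ax bf bg.
pose A := color_nbr c a; pose B := color_nbr c b.
have AK : involutive A by apply: color_nbrK.
have BK : involutive B by apply: color_nbrK.
have Ax : A x = x by apply: color_nbr_missing.
pose X := [set v | fconnect (fun v => B (A v)) x v].
have XA v : v \in X -> A v \in X by rewrite !inE; apply: dihedral_orbitA.
have XB v : v \in X -> B v \in X by rewrite !inE; apply: dihedral_orbitB.
have xX : x \in X by rewrite inE connect0.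
have inX h : connect (fan_step c x) e0 h -> b \in missing c (opp h x) -> opp h x \in X.
  move=> /connect_uniq[p [pp up ->]] bh; apply/contraT => nX; case: stuck.
  (* The fan is cut at its first edge whose far end misses [b] and lies off the chain. *)
  pose Q h := (b \in missing c (opp h x)) && (opp h x \notin X).
  have [|q [pq uq /andP[Qb QX] nQ _]] := @first_on_path _ Q e0 p pp up; first exact/andP.
  pose c1 := kempe_swap c a b X.
  have pc1 : proper_partial c1 by apply: kempe_swap_proper.
  have c10 : c1 e0 = None by rewrite /c1 (kempe_swap_in _ _ _ xX xe0).
  (* The cut fan survives the swap: [a] does not occur at [x], colors other than [a] and [b] stay
     missing, and a far end missing [b] before the cut lies in [X], where nothing changes. *)
  have pq1 : path (fan_step c1 x) e0 q.
    elim: q (e0) pq nQ {uq Qb QX} => //= f1 q IHq f0 /andP[/andP[xf1 st] pq] nQ.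
    rewrite IHq // ?andbT; last by move=> u uq; apply: nQ; rewrite inE uq orbT.
    rewrite /fan_step xf1 /c1 (kempe_swap_in _ _ _ xX xf1) /=.
    case cf1: (c f1) st => [d|] //= dm.
    have da : d != a by apply: contraTneq ax => <-; apply/missingP=> /(_ f1 xf1).
    have [db|db] := eqVneq d b; last exact: kempe_swap_missing_other.
    apply: kempe_swap_missing_in => //; have := nQ f0; rewrite inE eqxx => /(_ isT).
    by rewrite /Q -db dm negbK.
  have a1x : a \in missing c1 x by apply: kempe_swap_missing_in.
  have a1y : a \in missing c1 (opp (last e0 q) x).
    exact: kempe_swap_missing Qb.
  have [c2 pc2 ec2] := fan_shift pc1 c10 xe0 pq1 uq a1x a1y.
  by exists c2 => // e /ec2[/kempe_swap_None].
have fx := opp_neq (fan_ends xe0 ef); have gx := opp_neq (fan_ends xe0 eg).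
(* Both far ends are fixed by [B] and lie on the chain of [x], which has only one end besides
   [x]. *)
apply: (dihedral_fixed_uniq AK BK Ax); rewrite 1?eq_sym //.
- by have := inX _ ef bf; rewrite inE.
- by have := inX _ eg bg; rewrite inE.
- exact: color_nbr_missing.
- exact: color_nbr_missing.
Qed.

(** * Counting the colors missing along a fan *)

Variables (D m : nat).
Hypothesis deg_le : forall v, #|[set e | v \in ends e]| <= D.
Hypothesis mult_le : forall v w, v != w ->
  #|[set e | (v \in ends e) && (w \in ends e)]| <= m.
Hypothesis kE : k = D + m.

Lemma card_missing c v : m <= #|missing c v|.
Proof.
rewrite -(leq_add2l D) -kE addnC -[leqLHS](card_ord k) -(cardsC (missing c v)) leq_add2l.
pose used := [set e | v \in ends e].
apply: leq_trans (deg_le v); rewrite -/used -(card_imset _ (@Some_inj _)).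
apply: leq_trans (leq_imset_card c _); apply: subset_leq_card.
apply/subsetP=> _ /imsetP[a am ->]; move: am; rewrite !inE negb_forall.
move=> /existsP[e]; rewrite negb_imply negbK => /andP[ve /eqP <-].
by apply: imset_f; rewrite inE.
Qed.

(** Let [F] be the edges reached by fans from [e0], and [Y] their far ends. The sets of colors
    missing at the points of [Y] are disjoint and have at least [m] elements each, while [F] has at
    most [m] edges per point of [Y]; so these colors are at least as many as the edges of [F]. But
    each of them occurs at [x], on an edge of [F] other than [e0], which makes them fewer. *)
Lemma no_stuck_coloring c e0 : proper_partial c -> c e0 = None ->
  (~ exists2 c', proper_partial c' & extends c c' e0) -> False.
Proof.
move=> pc c0 stuck.
have [x xe0] : exists x, x \in ends e0.
  by apply/set0Pn; rewrite -card_gt0 ends2.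
(* [e0] joins its two ends, so the multiplicity bound is positive and every vertex misses some
   color. *)
have m0 : 0 < m.
  apply: leq_trans (mult_le (opp_neq xe0)); rewrite card_gt0; apply/set0Pn.
  by exists e0; rewrite inE xe0 mem_opp.
have [a ax] : exists a, a \in missing c x.
  by apply/set0Pn; rewrite -card_gt0; apply: leq_trans m0 (card_missing c x).
pose F := [set f | connect (fan_step c x) e0 f].
have F0 : e0 \in F by rewrite inE connect0.
pose Y := (opp^~ x) @: F.
pose U := \bigcup_(y in Y) missing c y.
have UE : #|U| = \sum_(y in Y) #|missing c y|.
  pose P := [set missing c y | y in Y].
  have inj : {in Y &, injective (missing c)}.
    move=> _ _ /imsetP[f fF ->] /imsetP[g gF ->] E1.
    have [b bf] : exists b, b \in missing c (opp f x).
      by apply/set0Pn; rewrite -card_gt0; apply: leq_trans m0 (card_missing _ _).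
    rewrite !inE in fF gF.
    by apply: (@fan_missing_uniq c e0 x a b) => //; rewrite -E1.
  have tP : trivIset P.
    apply/trivIsetP=> _ _ /imsetP[_ /imsetP[f fF ->] ->] /imsetP[_ /imsetP[g gF ->] ->] ne.
    rewrite -setI_eq0; apply: contraR ne => /set0Pn[b]; rewrite inE => /andP[bf bg].
    rewrite !inE in fF gF.
    by rewrite (@fan_missing_uniq c e0 x a b f g).
  have -> : U = cover P by rewrite /U cover_imset.
  by rewrite -(eqP tP) /P big_imset.
have lowU : #|Y| * m <= #|U|.
  by rewrite UE -sum_nat_const leq_sum // => y _; apply: card_missing.
have upF : #|F| <= #|Y| * m.
  rewrite -sum_nat_const -sum1_card (partition_big_imset (opp^~ x)) /=.
  apply: leq_sum => _ /imsetP[f fF ->]; rewrite sum1_card.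
  have xf : x \in ends f by rewrite inE in fF; exact: fan_ends xe0 fF.
  apply: leq_trans (mult_le (opp_neq xf)); apply: subset_leq_card.
  apply/subsetP=> g; rewrite !inE /= => /andP[gF /eqP <-].
  have xg : x \in ends g by move: gF; rewrite ?inE; apply: fan_ends.
  by rewrite mem_opp.
have UF : #|U| <= #|F :\ e0|.
  rewrite -(card_imset _ (@Some_inj _)).
  apply: leq_trans (leq_imset_card c _); apply: subset_leq_card.
  apply/subsetP=> _ /imsetP[b bU ->].
  move: bU => /bigcupP[_ /imsetP[f fF ->] bf]; rewrite inE in fF.
  (* If [b] were free at [x] too, the fan ending at [f] could be shifted. *)
  have : b \notin missing c x.
    apply/negP=> bx; apply: stuck.
    have [p [pp up fE]] := connect_uniq fF.
    by apply: (fan_shift pc c0 xe0 pp up bx); rewrite -fE.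
  rewrite inE negb_forall => /existsP[g].
  rewrite negb_imply negbK => /andP[xg /eqP cg].
  apply/imsetP; exists g => //; rewrite !inE.
  rewrite (_ : g != e0) /=; last by apply: contraPneq cg => ->; rewrite c0.
  apply: connect_trans fF (connect1 _).
  by rewrite /fan_step xg cg.
have := leq_trans upF (leq_trans lowU UF).
by rewrite (cardsD1 e0) F0 ltnn.
Qed.

End Vizing.

(** A proper partial coloring with the most colored edges cannot be extended, so by
    [no_stuck_coloring] it is total. *)
Theorem vizing (V E : finType) (ends : E -> {set V}) (D m : nat) :
  (forall e, #|ends e| = 2) ->
  (forall v, #|[set e | v \in ends e]| <= D) ->
  (forall v w, v != w -> #|[set e | (v \in ends e) && (w \in ends e)]| <= m) ->
  exists c : E -> 'I_(D + m), forall e f v,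
    v \in ends e -> v \in ends f -> c e = c f -> e = f.
Proof.
move=> ends2 degD multm; pose k := D + m.
pose properb (c : {ffun E -> option 'I_k}) :=
  [forall e, forall f, forall v,
     [&& e != f, v \in ends e, v \in ends f & c e == c f] ==> (c e == None)].
have propP (c : {ffun E -> option 'I_k}) : reflect (proper_partial ends c) (properb c).
  apply: (iffP forallP) => [H e f v ef ve vf cef|H e].
    have /forallP/(_ f)/forallP/(_ v) := H e.
    by rewrite ef ve vf cef eqxx => /eqP.
  apply/forallP=> f; apply/forallP=> v; apply/implyP=> /and4P[ef ve vf /eqP cef].
  by apply/eqP/(H e f v).
have proper0 : properb [ffun => None] by apply/propP=> e f v; rewrite !ffunE.
pose colored (c : {ffun E -> option 'I_k}) := [set e | c e != None].
have [c /propP pc cmax] := arg_maxnP (fun c => #|colored c|) proper0.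
have full e0 : c e0 != None.
  apply/negP=> /eqP c0; apply: (no_stuck_coloring ends2 degD multm erefl pc c0).
  move=> [c' pc' ec']; have := cmax [ffun e => c' e].
  have -> : properb [ffun e => c' e] by apply/propP=> e f v; rewrite !ffunE; apply: pc'.
  move=> /(_ isT) /=; rewrite leqNgt => /negP; apply; apply: proper_card.
  apply/properP; split.
    apply/subsetP=> e; rewrite !inE ffunE; apply: contra => /eqP/ec'[->] //.
  by exists e0; rewrite !inE ?c0 // ffunE; apply/negP=> /eqP/ec'[_]; rewrite eqxx.
have col e : {a | c e = Some a} by case: (c e) (full e) => // a _; exists a.
exists (fun e => sval (col e)) => e f v ve vf.
case: (col e) (col f) => [a ca] [b cb] /= ab; rewrite -ab in cb.
exact: proper_inj pc ve vf ca cb.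
Qed.

(** * Euler's inequality and the faces of 3-connected plane graphs *)

Section EulerInequality.
Variable T : finType.
Implicit Types (s t : {perm T}) (A B : {set T}).

Definition stable2 s t B := [forall z in B, (s z \in B) && (t z \in B)].

(** The stable sets are the unions of components of the pair [s], [t]; so [A] has a point in each
    component, and [#|A|] bounds their number. *)
Definition meets_all_stable s t A :=
  [forall B : {set T}, stable2 s t B ==> (B != set0) ==> (A :&: B != set0)].

Lemma stable_mem s t B z : stable2 s t B -> z \in B -> (s z \in B) && (t z \in B).
Proof. by move=> /forallP/(_ z)/implyP. Qed.

Lemma stable_porbit s (B : {set T}) x y : (forall z, z \in B -> s z \in B) ->
  y \in porbit s x -> (y \in B) = (x \in B).
Proof.
move=> sB; suff half u v : v \in porbit s u -> u \in B -> v \in B.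
  by move=> xy; apply/idP/idP; apply: half; rewrite // porbit_sym.
move=> /porbitP[n ->]; elim: n => [|n IHn] uB; first by rewrite expg0 perm1.
by rewrite expgSr permM; apply/sB/IHn.
Qed.

(** A set with both or neither of [x] and [y] is preserved by their transposition. *)
Lemma stable_tperm s t B x y : (x \in B) = (y \in B) ->
  stable2 (tperm x y * s)%g t B -> stable2 s t B.
Proof.
move=> xy st; apply/forallP=> z; apply/implyP=> zB.
have /andP[_ ->] := stable_mem st zB; rewrite andbT.
have /(stable_mem st)/andP[+ _] : tperm x y z \in B.
  by case: tpermP => [zx|zy|//]; [rewrite -xy -zx | rewrite xy -zy].
by rewrite permM tpermK.
Qed.

(* Splitting a cycle of s at x and s x either splits a cycle of s * t, possibly
   at the cost of one more component, or merges two of them, and then x and s x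
   stay in one component. *)
Lemma euler_inequality s t A : meets_all_stable s t A ->
  #|porbits s| + #|porbits t| + #|porbits (s * t)%g| <= #|T| + #|A|.*2.
Proof.
(* The induction counts the splittings that reduce [s] to the identity. *)
have [n] := ubnP (#|T| - #|porbits s|).
elim: n s A => // n IHn s A ltn /forallP meetA.
have meet B : stable2 s t B -> [disjoint A & B] -> B = set0.
  move=> stB; rewrite -setI_eq0 => /eqP AB; apply/eqP.
  by have := meetA B; rewrite stB AB eqxx /= implybF negbK.
have [x sx|fix_s] := pickP (fun x => s x != x); last first.
  have s1 : s = 1%g.
    by apply/permP=> x; rewrite perm1; have := fix_s x => /negbFE/eqP.
  rewrite s1 mul1g -addnA addnn leq_add ?leq_imset_card // leq_double.
  apply: leq_trans (leq_imset_card (porbit t) A); apply: subset_leq_card.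
  apply/subsetP=> _ /imsetP[x _ ->].
  have /set0Pn[a /setIP[aA ax]] : A :&: porbit t x != set0.
    apply/negP; rewrite setI_eq0 => /(meet _ _) p0.
    suff /p0 /setP/(_ x) : stable2 s t (porbit t x) by rewrite porbit_id inE.
    apply/forallP=> z; apply/implyP=> zx; rewrite s1 perm1 zx /=.
    by rewrite -eq_porbit_mem (porbit_perm t 1 z) eq_porbit_mem.
  by apply/imsetP; exists a => //; apply/eqP; rewrite eq_porbit_mem porbit_sym.
(* Products act from left to right, so [s'] sends [x] to [s y] and fixes [y]: it has one cycle more
   than [s]. *)
pose y := s x; pose s' : {perm T} := (tperm x y * s)%g.
have xs : x \in porbit s y by rewrite porbit_sym; have := mem_porbit s 1 x; rewrite expg1.
have := porbits_mul_tperm s x y; rewrite /= xs addn0 eq_sym sx addn1 => cs; rewrite -/s' in cs.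
have := porbits_mul_tperm (s * t)%g x y; rewrite /= mulgA -/s' eq_sym sx addn1 => cst.
have cs'T : #|porbits s'| <= #|T| by apply: leq_imset_card.
have ltn' : #|T| - #|porbits s'| < n.
  have arith a b d : a = b.+1 -> a <= d -> d - b < n.+1 -> d - a < n by lia.
  exact: arith cs cs'T ltn.
have sE : (tperm x y * s')%g = s by rewrite mulgA tperm2 mul1g.
have [xst|xst] := boolP (x \in porbit (s * t)%g y); last first.
  have xs't : x \in porbit (s' * t)%g y.
    apply/contraT => nx; have := porbits_mul_tperm (s' * t)%g x y.
    rewrite /= mulgA sE nx eq_sym sx addn1 => cst'; move: cst; rewrite xst.
    have arith (a b : nat) : a + 2 = b.+1 -> b + 2 = a.+1 -> false by lia.
    by move/arith; apply.
  have mA : meets_all_stable s' t A.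
    apply/forallP=> B; apply/implyP=> stB; have := meetA B.
    rewrite (@stable_tperm _ _ _ x y) //; apply: stable_porbit xs't => z zB.
    by have /andP[/(stable_mem stB)/andP[_]] := stable_mem stB zB; rewrite permM.
  have arith (a a' b d d' e : nat) : a' = a.+1 -> d' + 2 = d.+1 ->
    a' + b + d' <= e -> a + b + d <= e by lia.
  by apply: (arith _ _ _ _ _ _ cs _ (IHn s' A ltn' mA)); rewrite -cst xst.
suff [z mz] : exists z, meets_all_stable s' t (z |: A).
  have zA : #|z |: A| <= #|A|.+1 by rewrite cardsU1; case: (z \notin A).
  have arith (a a' b d d' e f f' : nat) : f' <= f.+1 -> a' = a.+1 -> d' = d.+1 ->
    a' + b + d' <= e + f'.*2 -> a + b + d <= e + f.*2 by lia.
  apply: (arith _ _ _ _ _ _ _ _ zA cs _ (IHn s' _ ltn' mz)).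
  by rewrite -cst xst addn0.
(* One of [x] and [y] serves as the new point. Otherwise some stable sets [B1] without [x] and [B2]
   without [y] both avoid [A]; each must contain the other of the two points, so their union is
   stable under [s] as well and avoids [A], which is absurd. *)
apply/existsP; apply/contraT; rewrite negb_exists => /forallP no.
have bad z : exists B, [/\ stable2 s' t B, z \notin B, [disjoint A & B] & B != set0].
  have := no z; rewrite negb_forall => /existsP[B].
  rewrite !negb_imply => /and4P[stB B0 /eqP/setP AB _]; exists B; split=> //.
    by have := AB z; rewrite !inE eqxx /= => ->.
  rewrite -setI_eq0; apply/eqP/setP=> u; have := AB u; rewrite !inE.
  by case: (u \in A); rewrite ?orbT.
have [B1 [st1 x1 d1 n1]] := bad x; have [B2 [st2 y2 d2 n2]] := bad y.
have y1 : y \in B1.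
  apply: contraR n1 => y1; apply/eqP/meet => //.
  by apply: stable_tperm st1; rewrite (negPf x1) (negPf y1).
have x2 : x \in B2.
  apply: contraR n2 => x2; apply/eqP/meet => //.
  by apply: stable_tperm st2; rewrite (negPf x2) (negPf y2).
have : B1 :|: B2 = set0.
  apply: meet; last first.
    by rewrite -setI_eq0 setIUr setU_eq0 !setI_eq0 d1 d2.
  apply: (@stable_tperm _ _ _ x y); first by rewrite !inE x2 y1 orbT.
  apply/forallP=> u; apply/implyP; rewrite !inE => /orP[] uB.
    by have /andP[-> ->] := stable_mem st1 uB.
  by have /andP[-> ->] := stable_mem st2 uB; rewrite !orbT.
by move=> /setP/(_ y); rewrite !inE y1.
Qed.

End EulerInequality.

Lemma porbit2 (T : finType) (s : {perm T}) x : s (s x) = x -> porbit s x = [set x; s x].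
Proof.
move=> ssx; apply/setP=> y; rewrite !inE; apply/idP/orP => [/porbitP[n ->]|].
  elim: n => [|n]; first by rewrite expg0 perm1; left.
  by rewrite expgSr permM => -[]/eqP->; [right|left]; rewrite ?ssx.
by case=> /eqP ->; rewrite ?porbit_id //; have := mem_porbit s 1 x; rewrite expg1.
Qed.

Definition origin (G : cmap) (z : dart G) : vertex G :=
  Sub (porbit (node G) z) (imset_f _ (erefl true)).

(** * Vertices and edge cuts of simple 3-connected maps *)

Section Vertices.
Variable G : cmap.
Implicit Types (v w : vertex G) (x y z : dart G).

Lemma origin_val v z : z \in val v -> v = origin z.
Proof.
case: v => _ /[dup] /imsetP[y _ ->] P /= zy; apply/val_inj/eqP => /=.
by rewrite eq_porbit_mem porbit_sym.
Qed.

Lemma mem_origin z : z \in val (origin z).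
Proof. exact: porbit_id. Qed.

Lemma origin_ex v : exists z, v = origin z.
Proof.
case: v => _ /[dup] /imsetP[y _ ->] P; exists y; exact/val_inj.
Qed.

Lemma origin_eq x y : (origin x == origin y) = (y \in porbit (node G) x).
Proof. by rewrite -val_eqE /= eq_porbit_mem porbit_sym. Qed.

Lemma adjP v w : reflect (exists2 z, v = origin z & w = origin (edge G z)) (adj v w).
Proof.
apply: (iffP existsP) => [[z /andP[/origin_val -> /origin_val ->]]|[z -> ->]].
  by exists z.
by exists z; rewrite !mem_origin.
Qed.

Lemma porbit_edge x : porbit (edge G) x = [set x; edge G x].
Proof. by rewrite porbit2 // edgeK. Qed.

Lemma card_dart : #|dart G| = #|porbits (edge G)|.*2.
Proof.
rewrite -muln2 -sum_nat_const -sum1_card (partition_big_imset (porbit (edge G))) /=.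
apply: eq_bigr => _ /imsetP[x _ ->]; rewrite sum1dep_card.
have -> : [set y | porbit (edge G) y == porbit (edge G) x] = porbit (edge G) x.
  by apply/setP=> y; rewrite inE eq_porbit_mem.
by rewrite porbit_edge cards2 eq_sym edge_neq.
Qed.

Lemma card_vertex : #|{: vertex G}| = #|porbits (node G)|.
Proof. by rewrite card_sig; apply: eq_card. Qed.

Lemma card_face : #|{: face G}| = #|porbits (face_perm G)|.
Proof. by rewrite card_sig; apply: eq_card. Qed.

Hypotheses (nlG : loopless G) (sG : simple G) (cG : three_connected G).

(** The form in which 3-connectivity is applied: membership in [P] propagates along a path that
    avoids [S]. *)
Lemma separation (P S : {set vertex G}) v w : #|S| < 3 ->
  (forall u1 u2, u1 \in P -> u1 \notin S -> adj u1 u2 -> u2 \notin S -> u2 \in P) ->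
  v \in P -> v \notin S -> w \notin S -> w \in P.
Proof.
move=> S3 closed vP vS wS; have := (cG.2 S S3 v w vS wS) => /connectP[p pp ->].
elim: p v vP {vS} pp => //= u p IHp v vP /andP[/and3P[vu vS uS]].
by apply: IHp; apply: closed vu uS.
Qed.

Lemma origin_edge_neq x : origin (edge G x) != origin x.
Proof. by rewrite eq_sym origin_eq; apply: nlG. Qed.

(** Otherwise the at most two neighbors of [v] would separate it from one of the remaining vertices,
    of which there is at least one. *)
Lemma vdeg_ge3 v : 2 < vdeg v.
Proof.
rewrite ltnNge; apply/negP=> v2.
pose S := [set origin (edge G z) | z in val v].
have S3 : #|S| < 3 by apply: leq_ltn_trans (leq_imset_card _ _) _.
have [w] : exists w, w \notin v |: S.
  apply/existsP; rewrite -negb_forall; apply/negP=> /forallP all_in.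
  have : #|{: vertex G}| <= #|v |: S|.
    by rewrite -cardsT; apply: subset_leq_card; apply/subsetP=> u _.
  rewrite cardsU1 leqNgt => /negP; apply; apply: leq_ltn_trans _ cG.1.
  by case: (v \notin S); rewrite // ltnW.
rewrite in_setU1 negb_or => /andP[wv wS].
have vS : v \notin S.
  apply/negP=> /imsetP[z /origin_val -> /esym/eqP].
  by rewrite (negPf (origin_edge_neq z)).
have : w \in [set v]; last by rewrite inE (negPf wv).
apply: (separation S3) (set11 v) vS wS => u1 u2 /set1P -> _ /adjP[z vz ->].
by move=> /negP; case; apply/imsetP; exists z; rewrite // vz mem_origin.
Qed.

(** Closed under [node], [B] stands for a set of vertices. If at most two darts left it, their
    origins would separate it from the rest, so every vertex of [B] would be such an origin.
    Counting the darts at one of them, of degree at least 3, shows that all leaving darts start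
    there; it is then the only vertex of [B], and its degree is at most 2. *)
Lemma no_small_cut (B : {set dart G}) z0 : (forall z, z \in B -> node G z \in B) ->
  B != set0 -> z0 \notin B -> 2 < #|[set z in B | edge G z \notin B]|.
Proof.
move=> nB /set0Pn[x0 x0B] z0B; set C := [set _ in _ | _].
rewrite ltnNge; apply/negP=> C2.
pose S := @origin G @: C; pose BV := @origin G @: B.
have inBV z : (origin z \in BV) = (z \in B).
  apply/imsetP/idP => [[y yB /eqP]|zB]; last by exists z.
  by rewrite origin_eq => /(stable_porbit nB) <-.
have SC : #|S| <= #|C| by apply: leq_imset_card.
have S3 : #|S| < 3 by apply: leq_ltn_trans SC _.
have BVS : BV \subset S.
  apply/subsetP=> v vB; apply/contraT => vS; move: (z0B); rewrite -inBV => /negP; case.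
  apply: (separation S3 _ vB vS) => [u1 u2|].
    move=> zB zS /adjP[z u1E ->] _; move: zB zS; rewrite u1E !inBV => zB.
    apply: contraR => ezB.
    by apply: imset_f; rewrite inE zB.
  by apply: contra z0B => /imsetP[z]; rewrite inE -!inBV => /andP[+ _] ->.
pose v := origin x0; have vB : v \in BV by rewrite inBV.
have inv z : z \in val v -> z \in B by rewrite -inBV => /origin_val <-.
(* The darts at [v] that stay in [B] lead to vertices of [BV] other than [v], distinct because the
   graph is simple. *)
have degv : #|val v| < #|val v :&: C| + #|BV|.
  rewrite -(cardsID C (val v)) -addnS leq_add2l (cardsD1 v BV) vB ltnS.
  have inj : {in val v :\: C &, injective (fun z => origin (edge G z))}.
    move=> y z /setDP[yv _] /setDP[zv _] /eqP; rewrite origin_eq => yz.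
    apply: sG yz; rewrite -origin_eq; apply/eqP.
    by rewrite -(origin_val yv) -(origin_val zv).
  rewrite -(card_in_imset inj); apply: subset_leq_card.
  apply/subsetP=> _ /imsetP[z /setDP[zv zC] ->]; rewrite !inE inBV.
  rewrite (origin_val zv) origin_edge_neq /=.
  by move: zC; rewrite inE (inv z zv) /= negbK.
have v3 : 2 < #|val v| := vdeg_ge3 v.
have BVle : #|BV| <= #|C| by apply: leq_trans (subset_leq_card BVS) SC.
have CvC : #|val v :&: C| <= #|C| by apply: subset_leq_card; apply: subsetIr.
have CE : val v :&: C = C.
  have arith (a b d e : nat) : a < b + d -> 2 < a -> d <= e -> e <= 2 -> e <= b by lia.
  by apply/eqP; rewrite eqEcard subsetIr; apply: arith degv v3 BVle C2.
have BV1 : #|BV| <= 1.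
  rewrite -(cards1 v); apply: leq_trans (subset_leq_card BVS) (subset_leq_card _).
  apply/subsetP=> u /imsetP[z]; rewrite -CE => /setIP[/origin_val vz _] ->.
  by rewrite -vz set11.
have arith (a b d e : nat) :
  a < b + d -> 2 < a -> b <= e -> e <= 2 -> d <= 1 -> False by lia.
exact: arith degv v3 CvC C2 BV1.
Qed.

End Vertices.

(** * Faces of simple 3-connected plane maps *)

Section Faces.
Variable G : cmap.
Hypotheses (pG : plane_graph G) (sG : simple G) (cG : three_connected G).
Implicit Types (x y z : dart G).

Let nlG : loopless G. Proof. by case: pG. Qed.

(** There are two darts per edge, so this is Euler's formula, in the shape of equality in
    [euler_inequality] for a singleton [A]. *)
Lemma planar_porbits :
  #|porbits (edge G)| + #|porbits (node G)| + #|porbits (face_perm G)| = #|dart G| + 2.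
Proof.
case: pG => _ _; rewrite /planar card_vertex card_face card_dart.
move: #|porbits (node G)| #|porbits (edge G)| #|porbits (face_perm G)| => a b d; lia.
Qed.

(** The hypothesis violates [euler_inequality] for the singleton of [x], so some component avoids
    [x]. *)
Lemma small_cut (s : {perm dart G}) x :
  #|dart G| + 2 < #|porbits s| + #|porbits (node G)| + #|porbits (s * node G)%g| ->
  exists B : {set dart G}, [/\ B != set0, x \notin B,
    (forall z, z \in B -> node G z \in B) & (forall z, z \in B -> s z \in B)].
Proof.
move=> big; have : ~~ meets_all_stable s (node G) [set x].
  by apply: contraL big => /euler_inequality; rewrite cards1 -leqNgt.
rewrite negb_forall => /existsP[B].
rewrite !negb_imply => /and4P[stB B0 /eqP/setP xB _]; exists B; split=> //.
- by have := xB x; rewrite !inE eqxx /= => ->.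
- by move=> z /(stable_mem stB)/andP[].
- by move=> z /(stable_mem stB)/andP[].
Qed.

(** It fixes [x] and [edge G x]: the edge is deleted but its darts remain, so [node G] need not
    change. *)
Let cut_edge x : {perm dart G} := (tperm x (edge G x) * edge G)%g.

Lemma card_cut_edge x : #|porbits (cut_edge x)| = #|porbits (edge G)|.+1.
Proof.
have := porbits_mul_tperm (edge G) x (edge G x).
by rewrite /= porbit_edge edgeK !inE eqxx orbT addn0 eq_sym edge_neq addn1.
Qed.

Lemma cut_edge_id x z : z != x -> z != edge G x -> cut_edge x z = edge G z.
Proof. by move=> zx zex; rewrite permM tpermD // eq_sym. Qed.

(** Deleting an edge with the same face on both sides would split that face, so by Euler's
    inequality the graph would have a cut of one edge. *)
Lemma edge_face_neq x : edge G x \notin porbit (face_perm G) x.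
Proof.
apply/negP=> xf.
have := porbits_mul_tperm (face_perm G) x (edge G x).
rewrite /= porbit_sym xf addn0 eq_sym edge_neq addn1 => cF.
have [|B [B0 xB nB sB]] := @small_cut (cut_edge x) x.
  rewrite card_cut_edge -mulgA cF -planar_porbits.
  by set a := #|_|; set b := #|_|; set d := #|_|; lia.
have := no_small_cut nlG sG cG nB B0 xB; rewrite ltnNge => /negP; apply.
apply: (@leq_trans #|[set edge G x]|); last by rewrite cards1.
apply: subset_leq_card; apply/subsetP=> z; rewrite !inE => /andP[zB].
apply: contraR => zex; rewrite -(@cut_edge_id x) ?sB //.
by apply: contraTneq zB => ->.
Qed.

(* Deleting the edges of x and y merges the faces of x and edge x and then
   splits the result, so by the Euler inequality it disconnects the graph. *)
Lemma faces_share_one_edge x y : y \in porbit (face_perm G) x ->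
  edge G y \in porbit (face_perm G) (edge G x) -> y = x.
Proof.
move=> yx eyx; apply/eqP/negPn/negP => nyx.
have nex : edge G x != x by apply: edge_neq.
have nyex : y != edge G x.
  by apply: contraNneq (edge_face_neq x) => <-.
have neyx : edge G y != x by apply: contraNneq nyex => <-; rewrite edgeK.
have neyex : edge G y != edge G x by rewrite (inj_eq perm_inj).
(* The face permutation after deleting the edge of [x]: the two faces beside it become one orbit. *)
pose t1 := (tperm x (edge G x) * face_perm G)%g.
have ct1 : #|porbits t1| + 2 = #|porbits (face_perm G)|.+1.
  have := porbits_mul_tperm (face_perm G) x (edge G x).
  by rewrite /= porbit_sym edge_face_neq eq_sym nex addn1.
have ext1 : edge G x \in porbit t1 x.
  rewrite porbit_sym; apply/contraT => nx.
  have := porbits_mul_tperm t1 x (edge G x).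
  rewrite /= nx mulgA tperm2 mul1g eq_sym nex addn1 => ct1'.
  have arith (a b : nat) : a + 2 = b.+1 -> b + 2 = a.+1 -> false by lia.
  exact: arith ct1 ct1'.
have stO z : z \in porbit t1 x -> face_perm G z \in porbit t1 x.
  move=> zO; have -> : face_perm G z = t1 (tperm x (edge G x) z) by rewrite [RHS]permM tpermK.
  have : tperm x (edge G x) z \in porbit t1 x.
    by case: tpermP; rewrite ?porbit_id.
  by rewrite -!eq_porbit_mem (porbit_perm t1 1).
have yO : y \in porbit t1 x by rewrite (stable_porbit stO yx) porbit_id.
have eyO : edge G y \in porbit t1 x by rewrite (stable_porbit stO eyx).
have yey : y \in porbit t1 (edge G y).
  by move: yO eyO; rewrite -!eq_porbit_mem => /eqP -> /eqP ->.
pose s := (tperm y (edge G y) * cut_edge x)%g.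
have cs : #|porbits s| = #|porbits (edge G)|.+2.
  have := porbits_mul_tperm (cut_edge x) y (edge G y).
  rewrite /= (_ : y \in _) /=.
    by rewrite addn0 eq_sym edge_neq addn1 card_cut_edge.
  rewrite porbit_sym; have := mem_porbit (cut_edge x) 1 y.
  by rewrite expg1 cut_edge_id.
have cf : #|porbits (s * node G)%g| = #|porbits (face_perm G)|.
  have := porbits_mul_tperm t1 y (edge G y).
  rewrite /= yey addn0 eq_sym edge_neq addn1 /s -!mulgA => ->.
  have arith (a b : nat) : a + 2 = b.+1 -> a.+1 = b by lia.
  exact: arith ct1.
have [|B [B0 xB nB sB]] := @small_cut s x.
  rewrite cs cf -planar_porbits.
  by set a := #|_|; set b := #|_|; set d := #|_|; lia.
have := no_small_cut nlG sG cG nB B0 xB; rewrite ltnNge => /negP; apply.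
(* As [x] is outside [B], a dart leaving [B] is [edge G x] or a dart of the edge of [y]; of the
   latter two, one leaves only if the other is outside. *)
apply: (@leq_trans #|[set edge G x; if y \in B then y else edge G y]|); last first.
  by rewrite cards2; case: (_ != _).
apply: subset_leq_card; apply/subsetP=> z; rewrite !inE => /andP[zB ezB].
have [//|/= zex] := eqVneq z (edge G x).
have zx : z != x by apply: contraTneq zB => ->.
have [zy|zy] := eqVneq z y; first by rewrite -zy zB eqxx.
have [zey|zey] := eqVneq z (edge G y).
  by move: ezB; rewrite zey edgeK => /negPf ->.
have := sB z zB; rewrite permM tpermD 1?eq_sym // cut_edge_id //.
by rewrite (negPf ezB).
Qed.

End Faces.

(** * Subdivisions *)

(* [p] sends a dart of G to the dart of R whose subdivided path contains it. *)
Record base_dart_map (R G : cmap) (h : dart R -> dart G) (p : dart G -> dart R) : Prop :=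
  BaseDartMap {
  base_h : forall y, p (h y) = y;
  base_edge : forall z, p (edge G z) = edge R (p z);
  base_node2 : forall z, z != h (p z) -> node G (node G z) = z;
  base_node : forall z, z != h (p z) -> p (node G z) = edge R (p z);
  base_pred : forall z, z != h (p z) -> exists2 z', face_perm G z' = z & p z' = p z }.

(** A dart with [z != h (p z)] is not the first of its path, so it starts at a new vertex; the last
    four fields describe the map there. *)
Lemma subdivision_base_dart_map (R G : cmap) (h : dart R -> dart G) :
  subdivision h -> exists p, base_dart_map h p.
Proof.
elim=> [|G1 G2 h1 i x a b _ [p bp] es].
  by exists id; split=> // z; rewrite eqxx.
have fE (H : cmap) u : face_perm H u = node H (edge H u) by rewrite permM.
(* The dart [b] continues [x], and [a] continues [edge G1 x]. *)
pose p' z := if [pick y | i y == z] is Some y then p y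
             else if z == b then p x else p (edge G1 x).
have p'i y : p' (i y) = p y.
  rewrite /p'; case: pickP => [y' /eqP/(esub_inj es) -> //|/(_ y)].
  by rewrite eqxx.
have p'b : p' b = p x.
  rewrite /p'; case: pickP => [y|_]; last by rewrite eqxx.
  by rewrite (negPf (esub_new_b es y)).
have p'a : p' a = p (edge G1 x).
  rewrite /p'; case: pickP => [y|_]; last by rewrite (negPf (esub_neq es)).
  by rewrite (negPf (esub_new_a es y)).
have ea : edge G2 a = i x by rewrite -(esub_edge_x es) edgeK.
have eex : edge G2 (i (edge G1 x)) = b by rewrite -(esub_edge_b es) edgeK.
exists p'; split.
- by move=> y; rewrite p'i (base_h bp).
- move=> z; case: (esub_cover es z) => [->|->|[y ->]].
  + by rewrite ea p'i p'a (base_edge bp) edgeK.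
  + by rewrite (esub_edge_b es) p'i p'b (base_edge bp).
  have [->|yx] := eqVneq y x; first by rewrite (esub_edge_x es) p'a p'i (base_edge bp).
  have [->|yex] := eqVneq y (edge G1 x).
    by rewrite eex p'b p'i (base_edge bp) edgeK.
  by rewrite (esub_edge es) // !p'i (base_edge bp).
- move=> z; case: (esub_cover es z) => [->|->|[y ->]].
  + by rewrite (esub_node_a es) (esub_node_b es).
  + by rewrite (esub_node_b es) (esub_node_a es).
  by rewrite p'i (inj_eq (esub_inj es)) !(esub_node es) => /(base_node2 bp) ->.
- move=> z; case: (esub_cover es z) => [->|->|[y ->]].
  + by rewrite (esub_node_a es) p'a p'b (base_edge bp) edgeK.
  + by rewrite (esub_node_b es) p'a p'b (base_edge bp).
  by rewrite p'i (inj_eq (esub_inj es)) (esub_node es) p'i => /(base_node bp) ->.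
- move=> z; case: (esub_cover es z) => [->|->|[y ->]].
  + by exists (i (edge G1 x)); rewrite ?p'i ?p'a // fE eex (esub_node_b es).
  + by exists (i x); rewrite ?p'i ?p'b // fE (esub_edge_x es) (esub_node_a es).
  rewrite p'i (inj_eq (esub_inj es)) => /(base_pred bp)[y' <- <-]; rewrite fE.
  have [->|yx] := eqVneq y' x.
    by exists b; rewrite ?p'b // fE (esub_edge_b es) (esub_node es).
  have [->|yex] := eqVneq y' (edge G1 x).
    by exists a; rewrite ?p'a // fE ea (esub_node es) edgeK.
  by exists (i y'); rewrite ?p'i // fE (esub_edge es) // (esub_node es).
Qed.

Lemma deg2_path_le (G : cmap) (s : seq (vertex G)) :
  deg2_path s -> size s <= longest_deg2_path G.
Proof.
move=> ds; have us : uniq s by case/and3P: ds.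
have ls : size s < #|{: vertex G}|.+1 by rewrite ltnS -(card_uniqP us) max_card.
apply: (bigmax_sup (Ordinal ls)) => //.
by apply/existsP; exists (in_tuple s).
Qed.

Lemma chi_c_colorable (G : cmap) : cyclically_colorable G (chi_c G).
Proof. by rewrite /chi_c; case: ex_minnP. Qed.

Lemma chi_c_min (G : cmap) k : cyclically_colorable G k -> chi_c G <= k.
Proof. by rewrite /chi_c; case: ex_minnP => m _; apply. Qed.

Definition dart_face (G : cmap) (z : dart G) : face G :=
  Sub (porbit (face_perm G) z) (imset_f _ (erefl true)).

Lemma dart_face_val (G : cmap) (f : face G) z : z \in val f -> f = dart_face z.
Proof.
case: f => _ /[dup] /imsetP[y _ ->] P /= zy; apply/val_inj/eqP => /=.
by rewrite eq_porbit_mem porbit_sym.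
Qed.

Lemma mem_dart_face (G : cmap) (z : dart G) : z \in val (dart_face z).
Proof. exact: porbit_id. Qed.

Lemma dart_face_eq (G : cmap) (x y : dart G) :
  (dart_face x == dart_face y) = (y \in porbit (face_perm G) x).
Proof. by rewrite -val_eqE /= eq_porbit_mem porbit_sym. Qed.

(** * The subdivided paths along the faces *)

Section BaseDartMap.
Variables (R G : cmap) (h : dart R -> dart G) (p : dart G -> dart R).
Hypotheses (sub : subdivision h) (bp : base_dart_map h p).
Implicit Types z : dart G.

(** Induction along the face walk, restarting the count at every dart that begins a path; any other
    dart has its predecessor on the same path. *)
Lemma fiber_chain n y z : z = iter n (face_perm G) (h y) ->
  exists2 j, z = iter j (face_perm G) (h (p z)) &
    forall i, i <= j -> p (iter i (face_perm G) (h (p z))) = p z.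
Proof.
elim: n z => [|n IHn] z zE.
  have pz : p z = y by rewrite zE /= (base_h bp).
  exists 0; first by rewrite pz.
  by move=> [|i] // _; rewrite /= (base_h bp).
have [zh|zh] := eqVneq z (h (p z)).
  by exists 0 => // -[|i] // _; rewrite /= (base_h bp).
have [z' z'z pz'] := base_pred bp zh.
have [|j z'E jE] := IHn z'; first by apply: (@perm_inj _ (face_perm G)); rewrite z'z zE.
rewrite pz' in z'E jE; have zE' : z = iter j.+1 (face_perm G) (h (p z)).
  by rewrite iterS -z'E.
exists j.+1 => // i; rewrite leq_eqVlt => /orP[/eqP ->|]; first by rewrite -zE'.
exact: jE.
Qed.

Lemma fiber_ex z : exists2 j, z = iter j (face_perm G) (h (p z)) &
    forall i, i <= j -> p (iter i (face_perm G) (h (p z))) = p z.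
Proof.
have [y] := subdivision_face_surj sub z; rewrite porbit_sym => /porbitP[n zE].
by apply: (@fiber_chain n y); rewrite zE permX.
Qed.

Lemma face_base z : h (p z) \in porbit (face_perm G) z.
Proof. by have [j zE _] := fiber_ex z; rewrite porbit_sym {1}zE -permX mem_porbit. Qed.

(** A dart lies on the same face as the first dart of its path, so faces of [G] can be compared in
    [R]. *)
Lemma face_base_eq z w :
  (w \in porbit (face_perm G) z) = (p w \in porbit (face_perm R) (p z)).
Proof.
rewrite -(subdivision_face sub) -!eq_porbit_mem.
have := face_base z; have := face_base w; rewrite -!eq_porbit_mem.
by move=> /eqP -> /eqP ->.
Qed.

Lemma new_origin z : z != h (p z) -> porbit (node G) z = [set z; node G z].
Proof. by move=> /(base_node2 bp)/porbit2. Qed.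

Lemma new_same_vertex z w : z != h (p z) -> w \in porbit (node G) z ->
  w = z \/ w = node G z /\ p w = edge R (p z).
Proof.
move=> nz; rewrite new_origin // !inE => /orP[]/eqP ->; first by left.
by right; rewrite (base_node bp).
Qed.

(** The darts over [r] form an initial segment of the face walk from [h r]; those after the first
    start at consecutive vertices of degree 2. *)
Lemma card_new_fiber r :
  #|[set z | (p z == r) && (z != h r)]| <= longest_deg2_path G.
Proof.
pose f := face_perm G; have f_inj : injective f := @perm_inj _ f.
have fib z : p z = r -> fconnect f (h r) z.
  by move=> <-; have [j zE _] := fiber_ex z; rewrite {2}zE fconnect_iter.
have r0 : p (h r) == r by rewrite (base_h bp).
(* [z0] is the last dart of the path over [r]. *)
have [z0 /eqP pz0 kmax] := @arg_maxnP _ (h r) (fun z => p z == r) (findex f (h r)) r0.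
pose k := findex f (h r) z0.
have kord : k < fingraph.order f (h r) by apply: findex_max (fib _ pz0).
have kfib i : i <= k -> p (iter i f (h r)) = r.
  move=> ik; have [j z0E jE] := fiber_ex z0; rewrite pz0 in z0E jE.
  apply: jE; apply: leq_trans ik _; rewrite /k {1}z0E.
  (* The walk of [j] steps might go round the face, but then [j] exceeds the index of [z0] all the
     more. *)
  case: (ltnP j (fingraph.order f (h r))) => [jo|jo]; first by rewrite findex_iter.
  by rewrite -/f -z0E; apply: leq_trans (ltnW kord) jo.
have utr : uniq (traject f (h r) k.+1).
  by rewrite -(take_traject f (h r) kord) take_uniq // orbit_uniq.
pose s := traject f (f (h r)) k.
have sP z : z \in s -> p z = r /\ z != h (p z).
  move=> zs; have pz : p z = r.
    have /trajectP[i ik ->] : z \in traject f (h r) k.+1 by rewrite trajectS inE zs orbT.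
    by apply: kfib.
  split=> //; rewrite pz; apply: contraTneq utr => zh.
  by rewrite zh in zs; rewrite trajectS cons_uniq zs.
have : deg2_path (map (@origin G) s).
  apply/and3P; split.
  - rewrite map_inj_in_uniq; first by move: utr; rewrite trajectS => /andP[].
    (* Two different darts at a new vertex lie over opposite darts of [R], so darts over the same
       [r] have distinct origins. *)
    move=> z w /sP[pz nz] /sP[pw nw] /eqP; rewrite origin_eq.
    move=> /(new_same_vertex nz)[] // [_ /eqP]; rewrite pz pw eq_sym.
    by rewrite (negPf (edge_neq _)).
  - have : sorted (frel f) s by rewrite /s; case: (k) => // n; rewrite /= fpath_traject.
    apply: homo_sorted => z w /eqP <-; apply/adjP; exists z => //.
    apply/eqP; rewrite eq_sym origin_eq /f permM.
    by have := mem_porbit (node G) 1 (edge G z); rewrite expg1.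
  - apply/allP=> _ /mapP[z /sP[pz nz] ->]; rewrite /vdeg /= new_origin // cards2.
    rewrite (_ : z != _) //; apply/negP=> /eqP zn.
    have := base_node bp nz; rewrite -zn => /esym/eqP.
    by rewrite (negPf (edge_neq _)).
move=> /deg2_path_le; apply: leq_trans; rewrite size_map.
apply: leq_trans (card_size s); apply: subset_leq_card; apply/subsetP=> z.
rewrite inE => /andP[/eqP pz zh].
have zE := iter_findex (fib z pz).
have zk : findex f (h r) z <= k by apply: kmax; apply/eqP.
have : z \in traject f (h r) k.+1 by apply/trajectP; exists (findex f (h r) z).
by rewrite trajectS inE (negPf zh).
Qed.

End BaseDartMap.

(** * The multigraph of new vertices and the coloring *)

Section UpperBound.
Variables (R G : cmap) (h : dart R -> dart G) (p : dart G -> dart R).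
Hypotheses (sub : subdivision h) (bp : base_dart_map h p).
Implicit Types (z : dart G) (u : vertex G).

Lemma lift_vertex_subproof (v : vertex R) : h @: val v \in porbits (node G).
Proof. by have [y ->] := origin_ex v; rewrite /= -(subdivision_vertex sub) imset_f. Qed.

Definition lift_vertex (v : vertex R) : vertex G :=
  Sub (h @: val v) (lift_vertex_subproof v).

Lemma lift_vertex_inj : injective lift_vertex.
Proof. by move=> v w /(congr1 val)/=/(imset_inj (subdivision_inj sub))/val_inj. Qed.

Lemma incident_lift v (f : {set dart G}) :
  incident (lift_vertex v) f = incident v (base_face h f).
Proof.
apply/existsP/existsP => [[_ /andP[/imsetP[y yv ->] yf]]|[y /andP[yv yf]]].
  by exists y; rewrite yv inE.
by exists (h y); rewrite imset_f //; rewrite inE in yf.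
Qed.

Definition new_vertex u := [forall z in val u, z != h (p z)].

Lemma new_vertexP u z : new_vertex u -> z \in val u -> z != h (p z).
Proof. by move=> /forallP/(_ z)/implyP. Qed.

Lemma lift_vertex_old v : ~~ new_vertex (lift_vertex v).
Proof.
have [y ->] := origin_ex v; apply/negP=> /new_vertexP /(_ (imset_f h (porbit_id _ y))).
by rewrite (base_h bp) eqxx.
Qed.

Lemma old_vertex_lift u : ~~ new_vertex u -> exists v, lift_vertex v == u.
Proof.
rewrite negb_forall => /existsP[z]; rewrite negb_imply negbK => /andP[zu /eqP zh].
exists (origin (p z)); rewrite -val_eqE /= -(subdivision_vertex sub) -zh.
by rewrite (origin_val zu).
Qed.

Notation newvert := {u : vertex G | new_vertex u}.

Definition new_ends (e : newvert) : {set face G} := [set f | incident (val e) (val f)].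

(** The lifts of the vertices of the base face and the new vertices on [f] are disjoint sets of
    vertices incident with [f]. *)
Lemma new_vertex_face_degree (f : face G) :
  #|[set e : newvert | f \in new_ends e]| <= fdeg (val f) - fdeg (base_face h (val f)).
Proof.
rewrite leq_subRL ?(leq_fdeg_base_face sub) //.
rewrite -(card_imset _ val_inj) {1}/fdeg -(card_imset _ lift_vertex_inj).
set A := _ @: _; set B := _ @: _.
have AB : [disjoint A & B].
  rewrite -setI_eq0; apply/eqP/setP=> u; rewrite !inE.
  apply/negP=> /andP[/imsetP[v _ ->] /imsetP[e _ ve]].
  by have := lift_vertex_old v; rewrite ve (valP e).
move: AB; rewrite -leq_card_setU => /eqP <-; apply: subset_leq_card.
apply/subsetP=> u; rewrite !inE => /orP[]/imsetP[].
  by move=> v; rewrite inE => vf ->; rewrite incident_lift.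
by move=> e; rewrite !inE => ef ->.
Qed.

Hypotheses (pR : plane_graph R) (sR : simple R) (cR : three_connected R).

(** The two darts at a new vertex lie over opposite darts of [R], which [edge_face_neq] puts on
    different faces. *)
Lemma new_faces_neq z : z != h (p z) -> dart_face z != dart_face (node G z).
Proof.
move=> nz; rewrite dart_face_eq (face_base_eq sub bp) (base_node bp) //.
exact: edge_face_neq.
Qed.

Lemma incident_dart_face u f : incident u (val f) = [exists z in val u, f == dart_face z].
Proof.
apply: eq_existsb => z; congr (_ && _); apply/idP/eqP; first exact: dart_face_val.
by move=> ->; apply: mem_dart_face.
Qed.

Lemma card_new_ends e : #|new_ends e| = 2.
Proof.
case: e => u nu; have [z uz] := origin_ex u.
have nz : z != h (p z) by apply: (new_vertexP nu); rewrite uz mem_origin.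
have -> : new_ends (exist _ u nu) = [set dart_face z; dart_face (node G z)].
  apply/setP=> f; rewrite !inE incident_dart_face /= uz /= (new_origin bp nz).
  apply/existsP/orP => [[w]|]; first by rewrite !inE => /andP[/orP[]/eqP -> ->]; [left|right].
  by case=> fE; [exists z|exists (node G z)]; rewrite !inE eqxx ?orbT.
by rewrite cards2 new_faces_neq.
Qed.

(** A common new vertex has one dart on [f] and its other dart on [g]. By [faces_share_one_edge] all
    these darts on [f] lie over a single dart of [R], so [card_new_fiber] applies. *)
Lemma card_common_new (f g : face G) : f != g ->
  #|[set e : newvert | (f \in new_ends e) && (g \in new_ends e)]| <= longest_deg2_path G.
Proof.
move=> fg; set M := [set _ | _].
have common e : e \in M -> exists z, [/\ val e = origin z, z != h (p z),
    f = dart_face z & g = dart_face (node G z)].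
  rewrite !inE !incident_dart_face => /andP[/existsP[z /andP[ze /eqP fz]]].
  move=> /existsP[w /andP[we /eqP gw]]; exists z.
  have nz := new_vertexP (valP e) ze; have ez := origin_val ze; split=> //.
  move: we; rewrite ez => /(new_same_vertex bp nz)[wz|[<- _]] //.
  by move: fg; rewrite fz gw wz eqxx.
have [->|/set0Pn[e0 /common[z0 [_ nz0 f0 g0]]]] := eqVneq M set0; first by rewrite cards0.
apply: leq_trans (card_new_fiber sub bp (p z0)).
rewrite -(card_imset _ val_inj); apply: leq_trans (leq_imset_card (@origin G) _).
apply: subset_leq_card; apply/subsetP=> _ /imsetP[e eM ->].
have [z [-> nz fz gz]] := common e eM; apply: imset_f; rewrite inE.
suff pz : p z = p z0 by rewrite -pz eqxx.
apply: (faces_share_one_edge pR sR cR).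
  by rewrite -(face_base_eq sub bp) -dart_face_eq -f0 fz.
by rewrite -!(base_node bp) // -(face_base_eq sub bp) -dart_face_eq -g0 gz.
Qed.

Lemma chi_c_subdivision_le :
  chi_c G <= (\max_(f : face G) (fdeg (val f) - fdeg (base_face h (val f))))
             + longest_deg2_path G + chi_c R.
Proof.
set D := \max_(f : face G) _.
have [col colP] := @vizing _ _ new_ends D (longest_deg2_path G) card_new_ends
  (fun f => leq_trans (new_vertex_face_degree f) (leq_bigmax f)) card_common_new.
have /existsP[cR' /forallP cRP] := chi_c_colorable R.
apply: chi_c_min.
have dec u : {e : newvert | val e = u} + {v | lift_vertex v == u}.
  have [nu|ou] := boolP (new_vertex u); first by left; exists (exist _ u nu).
  by right; apply: sigW; apply: old_vertex_lift.
(* With separate palettes only vertices of the same kind can clash: two new ones on a face are edges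
   with a common end, and two old ones are cofacial in [R]. *)
pose c u : 'I_(D + longest_deg2_path G) + 'I_(chi_c R) :=
  match dec u with inl e => inl (col (sval e)) | inr v => inr (cR' (sval v)) end.
apply/existsP; exists [ffun u => unsplit (c u)].
apply/forallP=> u; apply/forallP=> w; apply/implyP=> /andP[uw].
move=> /existsP[f /andP[uf wf]]; rewrite !ffunE (inj_eq (can_inj (@unsplitK _ _))).
rewrite /c; case: (dec u) => [[e eu]|[v vu]];
  case: (dec w) => [[e' ew]|[v' vw]] //=; apply: contraNneq uw => -[E1].
  by rewrite -eu -ew (@colP e e' f) ?eqxx // inE ?eu ?ew //.
move/eqP in vu; move/eqP in vw.
apply/negPn/negP=> uw; have /forallP/(_ v') := cRP v.
rewrite E1 eqxx implybF => /negP; apply; apply/andP; split.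
  by apply: contraNneq uw => vv; rewrite -vu -vw vv.
apply/existsP; exists (Sub (base_face h (val f)) (base_face_face sub f)).
by rewrite /= -!incident_lift vu vw uf.
Qed.

End UpperBound.

(** * A subdivided tetrahedron *)

Section Labels.
Variables (T : finType) (s : {perm T}) (lab : T -> nat) (m : nat).
Hypothesis lab_s : forall x, lab (s x) = lab x.
Hypothesis lab_orbit : forall x y, lab x = lab y -> exists2 i, i < m & y = iter i s x.

Lemma porbit_label x y : (y \in porbit s x) = (lab y == lab x).
Proof.
apply/porbitP/eqP => [[n ->]|/esym/lab_orbit[i _ ->]]; last by exists i; rewrite permX.
by rewrite permX; elim: n => //= n <-.
Qed.

Lemma card_porbit_label x : #|porbit s x| <= m.
Proof.
pose g (i : 'I_m) := iter i s x.
rewrite -[m]card_ord -cardsT; apply: leq_trans (leq_imset_card g _).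
apply: subset_leq_card; apply/subsetP=> y; rewrite porbit_label => /eqP/esym/lab_orbit.
by move=> [i im ->]; apply/imsetP; exists (Ordinal im).
Qed.

Lemma card_porbits_label k : (forall x, lab x < k) ->
  (forall l, l < k -> exists x, lab x = l) -> #|porbits s| = k.
Proof.
move=> lt_k surj; pose F (l : 'I_k) := [set x | lab x == l].
have F_inj : injective F.
  move=> l1 l2 /setP E1; have [x xl] := surj l1 (ltn_ord l1).
  by apply: val_inj; have := E1 x; rewrite !inE xl eqxx => /esym/eqP.
rewrite -[k]card_ord -cardsT -(card_imset _ F_inj); congr #|pred_of_set _|.
apply/setP=> B; apply/imsetP/imsetP => [[x _ ->]|[l _ ->]].
  by exists (Ordinal (lt_k x)) => //; apply/setP=> y; rewrite porbit_label inE.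
have [x xl] := surj l (ltn_ord l).
by exists x => //; apply/setP=> y; rewrite porbit_label inE xl.
Qed.

End Labels.

(* A map on the darts 0, ..., n - 1 given by the tables of its edge and node
   permutations. *)
Definition wf_tables (et nt : seq nat) :=
  let n := size et in
  [&& size nt == n, uniq nt,
      all (fun i => nth 0 nt i < n) (iota 0 n) &
      all (fun i => [&& nth 0 et i < n, nth 0 et (nth 0 et i) == i & nth 0 et i != i])
          (iota 0 n)].

Section TableMap.
Variables et nt : seq nat.
Hypothesis wf : wf_tables et nt.
Let n := size et.

Lemma table_edge_lt (i : 'I_n) : nth 0 et i < n.
Proof.
case/and4P: wf => _ _ _ /allP/(_ (val i)).
by rewrite mem_iota ltn_ord => /(_ isT)/and3P[].
Qed.

Lemma table_node_lt (i : 'I_n) : nth 0 nt i < n.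
Proof. by case/and4P: wf => _ _ /allP/(_ (val i)); rewrite mem_iota ltn_ord => /(_ isT). Qed.

Definition table_edge (i : 'I_n) : 'I_n := Ordinal (table_edge_lt i).
Definition table_node (i : 'I_n) : 'I_n := Ordinal (table_node_lt i).

Lemma table_edgeK : involutive table_edge.
Proof.
move=> i; apply: val_inj; case/and4P: wf => _ _ _ /allP/(_ (val i)).
by rewrite mem_iota ltn_ord => /(_ isT)/and3P[_ /eqP].
Qed.

Lemma table_edge_neq i : table_edge i != i.
Proof.
case/and4P: wf => _ _ _ /allP/(_ (val i)).
by rewrite mem_iota ltn_ord => /(_ isT)/and3P[].
Qed.

Lemma table_node_inj : injective table_node.
Proof.
case/and4P: wf => /eqP snt unt _ _ i j /(congr1 val)/eqP /=.
by rewrite nth_uniq ?snt // => /eqP/val_inj.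
Qed.

(** Transparent, so that its darts are convertible to elements of ['I_n]. *)
Definition table_map : cmap.
Proof.
refine (@CMap 'I_n (perm (can_inj table_edgeK)) (perm table_node_inj) _ _).
- by move=> x; rewrite !permE table_edgeK.
- by move=> x; rewrite permE table_edge_neq.
Defined.

Let M := table_map.
Let tval (x : dart M) : nat := nat_of_ord (x : 'I_n).

Lemma table_edgeE (x : dart M) : tval (edge M x) = nth 0 et (tval x).
Proof. by rewrite /tval permE. Qed.

Lemma table_nodeE (x : dart M) : tval (node M x) = nth 0 nt (tval x).
Proof. by rewrite /tval permE. Qed.

Lemma table_faceE (x : dart M) :
  tval (face_perm M x) = nth 0 nt (nth 0 et (tval x)).
Proof. by rewrite permM table_nodeE table_edgeE. Qed.

End TableMap.

(** The new darts get the next two numbers: [size et] is the partner of [x] and plays the role of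
    [a], its successor that of [b]. *)
Definition sub_edge_table (et : seq nat) x :=
  set_nth 0 (set_nth 0 et x (size et)) (nth 0 et x) (size et).+1 ++ [:: x; nth 0 et x].

Definition sub_node_table (et nt : seq nat) := nt ++ [:: (size et).+1; size et].

Section TableSubdivision.
Variables (et nt : seq nat) (x : nat).
Let et' := sub_edge_table et x.
Let nt' := sub_node_table et nt.
Let n := size et.
Hypotheses (wf : wf_tables et nt) (wf' : wf_tables et' nt') (xn : x < n).

Let ex_lt : nth 0 et x < n.
Proof. exact: table_edge_lt wf (Ordinal xn). Qed.

Lemma size_sub_edge_table : size et' = n.+2.
Proof.
rewrite /et' /sub_edge_table size_cat !size_set_nth addn2.
by rewrite (maxn_idPr xn) (maxn_idPr ex_lt).
Qed.

Let sz : n <= size et'. Proof. by rewrite size_sub_edge_table; lia. Qed.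
Let an : n < size et'. Proof. by rewrite size_sub_edge_table; lia. Qed.
Let bn : n.+1 < size et'. Proof. by rewrite size_sub_edge_table. Qed.

Lemma nth_sub_edge_table y : nth 0 et' y =
  if y < n then if y == nth 0 et x then n.+1 else if y == x then n else nth 0 et y
  else nth 0 [:: x; nth 0 et x] (y - n).
Proof.
rewrite /et' /sub_edge_table nth_cat !size_set_nth (maxn_idPr xn) (maxn_idPr ex_lt).
by case: ifP => // _; rewrite nth_set_nth /= nth_set_nth.
Qed.

Lemma nth_sub_node_table y : nth 0 nt' y =
  if y < n then nth 0 nt y else nth 0 [:: n.+1; n] (y - n).
Proof. by rewrite /nt' /sub_node_table nth_cat; case/and4P: wf => /eqP ->. Qed.

Lemma table_esub : @elementary_subdivision (table_map wf) (table_map wf')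
  (widen_ord sz) (Ordinal xn) (Ordinal an) (Ordinal bn).
Proof.
have lt (y : ordinal n) : (y < n) = true by apply: ltn_ord.
have nn : (n < n) = false := ltnn n.
have n1n : (n.+1 < n) = false by apply/negP; lia.
split.
- by move=> y z /(congr1 val)/= /val_inj.
- by rewrite -val_eqE /= ltn_eqF.
- by move=> y; rewrite -val_eqE /= ltn_eqF.
- by move=> y; rewrite -val_eqE /= ltn_eqF // ltnW // ltnS.
- move=> z; have := ltn_ord z; rewrite {2}size_sub_edge_table.
  rewrite ltnS leq_eqVlt ltnS leq_eqVlt => /or3P[/eqP zE|/eqP zE|zn].
  + by constructor 2; apply: val_inj.
  + by constructor 1; apply: val_inj.
  + by constructor 3; exists (Ordinal zn); apply: val_inj.
- apply: val_inj; rewrite permE /= nth_sub_edge_table xn eqxx.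
  have : nth 0 et x != x by apply: (table_edge_neq wf (Ordinal xn)).
  by rewrite eq_sym => /negPf ->.
- by apply: val_inj; rewrite !permE /= nth_sub_edge_table n1n subSn // subnn.
- move=> y yx yex; apply: val_inj; rewrite !permE /= nth_sub_edge_table lt.
  move: yx yex; rewrite permE -!val_eqE /= => /negPf -> /negPf ->; by [].
- by apply: val_inj; rewrite permE /= nth_sub_node_table nn subnn.
- by apply: val_inj; rewrite permE /= nth_sub_node_table n1n subSn // subnn.
- by move=> y; apply: val_inj; rewrite !permE /= nth_sub_node_table lt.
Qed.

End TableSubdivision.

Lemma all_ord n (P : pred nat) : all P (iota 0 n) -> forall x : 'I_n, P x.
Proof. by move=> /allP H x; apply: H; rewrite mem_iota /= ltn_ord. Qed.

(** Stated on plain numbers, so that evaluation decides it; [m] becomes a bound on the orbit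
    sizes. *)
Definition orbit_labels n (f lab : nat -> nat) m :=
  all (fun x => (lab (f x) == lab x) &&
    all (fun y => (lab x == lab y) ==> has (fun i => y == iter i f x) (iota 0 m))
        (iota 0 n)) (iota 0 n).

Section OrbitLabels.
Variables (n : nat) (s : {perm 'I_n}) (f lab : nat -> nat) (m : nat).
Hypothesis sE : forall x, s x = f x :> nat.
Hypothesis labels : orbit_labels n f lab m.

Lemma iter_ord i (x : 'I_n) : iter i s x = iter i f x :> nat.
Proof. by elim: i => //= i <-. Qed.

Lemma orbit_labels_s (x : 'I_n) : lab (s x) = lab x.
Proof. by have /andP[/eqP <- _] := all_ord labels x; rewrite sE. Qed.

Lemma orbit_labels_iter (x y : 'I_n) :
  lab x = lab y -> exists2 i, i < m & y = iter i s x.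
Proof.
move=> xy; have /andP[_ /all_ord/(_ y)] := all_ord labels x.
rewrite xy eqxx /= => /hasP[i]; rewrite mem_iota => im /eqP yE.
by exists i => //; apply: val_inj; rewrite /= iter_ord.
Qed.

Lemma mem_porbit_labels x y : (y \in porbit s x) = (lab y == lab x).
Proof. exact: porbit_label orbit_labels_s orbit_labels_iter x y. Qed.

Lemma card_porbit_labels x : #|porbit s x| <= m.
Proof. exact: card_porbit_label orbit_labels_s orbit_labels_iter x. Qed.

Lemma card_porbits_labels k : all (fun x => lab x < k) (iota 0 n) ->
  all (fun l => has (fun x => lab x == l) (iota 0 n)) (iota 0 k) -> #|porbits s| = k.
Proof.
move=> /all_ord lt_k /allP surj.
apply: (card_porbits_label orbit_labels_s orbit_labels_iter lt_k) => l lk.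
have /hasP[x] : has (fun x => lab x == l) (iota 0 n) by apply: surj; rewrite mem_iota.
by rewrite mem_iota /= => xn /eqP <-; exists (Ordinal xn).
Qed.

End OrbitLabels.

(** * Bounds for the example *)

Lemma cyclically_colorable_card (G : cmap) : cyclically_colorable G #|{: vertex G}|.
Proof.
apply/existsP; exists [ffun v => enum_rank v].
apply/forallP=> v; apply/forallP=> w; apply/implyP=> /andP[vw _].
by rewrite !ffunE (inj_eq enum_rank_inj).
Qed.

Lemma chi_c_ge_card (G : cmap) : (forall v w : vertex G, cofacial v w) ->
  #|{: vertex G}| <= chi_c G.
Proof.
move=> cof; have /existsP[c /forallP cP] := chi_c_colorable G.
rewrite -[leqRHS]card_ord; apply: (@leq_card _ _ c) => v w cvw.
apply/eqP/contraT => vw; have /forallP/(_ w) := cP v.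
by rewrite vw cof cvw eqxx.
Qed.

Lemma fdeg_le_card (G : cmap) (f : {set dart G}) : fdeg f <= #|f|.
Proof.
apply: leq_trans (leq_imset_card (@origin G) _); apply: subset_leq_card.
apply/subsetP=> v; rewrite inE => /existsP[z /andP[/origin_val -> zf]].
exact: imset_f.
Qed.

Lemma card_ge3 (T : finType) (A : {set T}) x y z : x \in A -> y \in A -> z \in A ->
  uniq [:: x; y; z] -> 2 < #|A|.
Proof.
move=> xA yA zA u; have <- : #|[:: x; y; z]| = 3 by rewrite (card_uniqP u).
apply: subset_leq_card; apply/subsetP=> t; rewrite !inE.
by move=> /or3P[]/eqP ->.
Qed.

Lemma fdeg_ge3 (G : cmap) (f : {set dart G}) x y z : x \in f -> y \in f -> z \in f ->
  uniq [:: origin x; origin y; origin z] -> 2 < fdeg f.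
Proof.
move=> xf yf zf; apply: card_ge3; rewrite inE; apply/existsP.
- by exists x; rewrite mem_origin.
- by exists y; rewrite mem_origin.
- by exists z; rewrite mem_origin.
Qed.

Lemma longest_deg2_path_le1 (G : cmap) :
  (forall z : dart G, 2 < vdeg (origin z) \/ 2 < vdeg (origin (edge G z))) ->
  longest_deg2_path G <= 1.
Proof.
move=> no2; apply/bigmax_leqP=> k /existsP[s].
case: s => -[|v [|w s]] /= /eqP <- //; rewrite /deg2_path /=.
move=> /and3P[_ /andP[/adjP[z -> ->] _]] /and3P[/eqP d1 /eqP d2 _].
by case: (no2 z); rewrite ?d1 ?d2.
Qed.

(* The tetrahedron, whose vertex v carries the darts 3v, 3v+1 and 3v+2. *)
Definition k4_edge := [:: 3; 6; 9; 0; 11; 7; 1; 5; 10; 2; 8; 4].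
Definition k4_node := [:: 1; 2; 0; 4; 5; 3; 7; 8; 6; 10; 11; 9].

Lemma k4_wf : wf_tables k4_edge k4_node. Proof. by []. Qed.

Definition K4 : cmap := table_map k4_wf.

Lemma k4_edgeE (x : dart K4) : (edge K4 x : 'I_12) = nth 0 k4_edge (x : 'I_12) :> nat.
Proof. exact: table_edgeE. Qed.

Lemma k4_nodeE (x : dart K4) : (node K4 x : 'I_12) = nth 0 k4_node (x : 'I_12) :> nat.
Proof. exact: table_nodeE. Qed.

Lemma k4_faceE (x : dart K4) :
  (face_perm K4 x : 'I_12) = nth 0 k4_node (nth 0 k4_edge (x : 'I_12)) :> nat.
Proof. exact: table_faceE. Qed.

Definition k4_vlab x := nth 0 [:: 0; 0; 0; 1; 1; 1; 2; 2; 2; 3; 3; 3] x.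
Definition k4_flab x := nth 0 [:: 0; 1; 2; 1; 0; 3; 2; 1; 3; 0; 2; 3] x.

Lemma k4_node_labels : orbit_labels 12 (nth 0 k4_node) k4_vlab 3. Proof. by []. Qed.

Lemma k4_face_labels :
  orbit_labels 12 (fun x => nth 0 k4_node (nth 0 k4_edge x)) k4_flab 3.
Proof. by []. Qed.

Lemma k4_vertex (x y : dart K4) :
  (y \in porbit (node K4) x) = (k4_vlab (y : 'I_12) == k4_vlab (x : 'I_12)).
Proof. exact: (mem_porbit_labels k4_nodeE k4_node_labels). Qed.

Lemma k4_loopless : loopless K4.
Proof.
move=> x; rewrite k4_vertex k4_edgeE.
by move: (x : 'I_12); apply: (@all_ord 12 (fun x => k4_vlab (nth 0 k4_edge x) != k4_vlab x)).
Qed.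

Lemma k4_connected : connected K4.
Proof.
move=> x y; set e := [rel a b | _].
have cn i z : connect e z (iter i (node K4) z).
  elim: i => [|i IHi]; first exact: connect0.
  by apply: connect_trans IHi (connect1 _); rewrite /= eqxx orbT.
have ce z : connect e z (edge K4 z) by apply: connect1; rewrite /= eqxx.
(* Any two darts are joined by turning at a vertex, or by turning, crossing one edge and turning
   again. *)
have chk : all (fun x => all (fun y => has (fun i => has (fun j =>
    (y == iter i (nth 0 k4_node) x) ||
    (y == iter j (nth 0 k4_node) (nth 0 k4_edge (iter i (nth 0 k4_node) x))))
    (iota 0 3)) (iota 0 3)) (iota 0 12)) (iota 0 12) by [].
have /hasP[i _ /hasP[j _]] := all_ord (all_ord chk x) y.
rewrite -!(iter_ord k4_nodeE) -k4_edgeE.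
rewrite -(iter_ord k4_nodeE) => /orP[]/eqP/val_inj ->; first exact: cn.
exact: connect_trans (cn i x) (connect_trans (ce _) (cn _ _)).
Qed.

Lemma k4_card_vertex : #|{: vertex K4}| = 4.
Proof.
rewrite card_vertex.
exact: (card_porbits_labels k4_nodeE k4_node_labels).
Qed.

Lemma k4_plane : plane_graph K4.
Proof.
split; [exact: k4_loopless | exact: k4_connected | rewrite /planar].
rewrite k4_card_vertex card_face.
rewrite (card_porbits_labels k4_faceE k4_face_labels (k := 4)) //.
have : 12 = #|porbits (edge K4)|.*2 by rewrite -card_dart card_ord.
by move: #|porbits (edge K4)| => a; lia.
Qed.

Lemma k4_simple : simple K4.
Proof.
move=> x y; rewrite !k4_vertex !k4_edgeE => /eqP yx /eqP eyx.
have chk : all (fun x => all (fun y => (k4_vlab y == k4_vlab x) ==>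
  (k4_vlab (nth 0 k4_edge y) == k4_vlab (nth 0 k4_edge x)) ==> (x == y)) (iota 0 12))
  (iota 0 12) by [].
have := all_ord (all_ord chk x) y.
by rewrite yx eyx !eqxx /= => /eqP/val_inj.
Qed.

(** Any two vertices are adjacent, so one edge joins them whatever [S] is removed. *)
Lemma k4_three_connected : three_connected K4.
Proof.
split; first by rewrite k4_card_vertex.
move=> S _ v w vS wS; have [<-|vw] := eqVneq v w; first exact: connect0.
apply: connect1; rewrite /= vS wS !andbT.
have [x xv] := origin_ex v; have [y yw] := origin_ex w; subst v w.
have chk : all (fun x => all (fun y => (k4_vlab y != k4_vlab x) ==>
  has (fun i => k4_vlab (nth 0 k4_edge (iter i (nth 0 k4_node) x)) == k4_vlab y)
      (iota 0 3)) (iota 0 12)) (iota 0 12) by [].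
have := all_ord (all_ord chk x) y; rewrite -k4_vertex -origin_eq vw implyTb.
move=> /hasP[i _]; rewrite -(iter_ord k4_nodeE) -k4_edgeE.
rewrite -k4_vertex -origin_eq => /eqP yE; apply/adjP.
exists (iter i (node K4) x); last by rewrite yE.
by apply/eqP; rewrite origin_eq -permX mem_porbit.
Qed.

Lemma k4_fdeg (x : dart K4) : 2 < fdeg (porbit (face_perm K4) x).
Proof.
pose F := face_perm K4.
have next y : F y \in porbit F y by have := mem_porbit F 1 y; rewrite expg1.
have next2 : F (F x) \in porbit F x.
  by have := mem_porbit F 2 x; rewrite expgS expg1 permM.
apply: (fdeg_ge3 (porbit_id F x) (next x) next2).
rewrite !cons_uniq !inE !origin_eq !k4_vertex !k4_faceE !andbT negb_or -andbA.
by move: (x : 'I_12); apply: (@all_ord 12 (fun x =>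
  let f x := nth 0 k4_node (nth 0 k4_edge x) in
  [&& k4_vlab (f x) != k4_vlab x, k4_vlab (f (f x)) != k4_vlab x
    & k4_vlab (f (f x)) != k4_vlab (f x)])).
Qed.

(* The darts 0, 1 and 2, which leave the vertex 0, are subdivided in turn. *)
Definition spoke_edge1 := sub_edge_table k4_edge 0.
Definition spoke_node1 := sub_node_table k4_edge k4_node.
Definition spoke_edge2 := sub_edge_table spoke_edge1 1.
Definition spoke_node2 := sub_node_table spoke_edge1 spoke_node1.
Definition spoke_edge := sub_edge_table spoke_edge2 2.
Definition spoke_node := sub_node_table spoke_edge2 spoke_node2.

Lemma spoke_wf1 : wf_tables spoke_edge1 spoke_node1. Proof. by []. Qed.
Lemma spoke_wf2 : wf_tables spoke_edge2 spoke_node2. Proof. by []. Qed.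
Lemma spoke_wf : wf_tables spoke_edge spoke_node. Proof. by []. Qed.

Definition spoke_map : cmap := table_map spoke_wf.

Lemma spoke_subdivision : exists h : dart K4 -> dart spoke_map, subdivision h.
Proof.
eexists; apply: subdivision_step (table_esub spoke_wf2 spoke_wf (isT : 2 < 16)).
apply: subdivision_step (table_esub spoke_wf1 spoke_wf2 (isT : 1 < 14)).
apply: subdivision_step (table_esub k4_wf spoke_wf1 (isT : 0 < 12)).
exact: subdivision_refl.
Qed.

Lemma spoke_edgeE (x : dart spoke_map) :
  (edge spoke_map x : 'I_18) = nth 0 spoke_edge (x : 'I_18) :> nat.
Proof. exact: table_edgeE. Qed.

Lemma spoke_nodeE (x : dart spoke_map) :
  (node spoke_map x : 'I_18) = nth 0 spoke_node (x : 'I_18) :> nat.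
Proof. exact: table_nodeE. Qed.

Lemma spoke_faceE (x : dart spoke_map) :
  (face_perm spoke_map x : 'I_18) = nth 0 spoke_node (nth 0 spoke_edge (x : 'I_18)) :> nat.
Proof. exact: table_faceE. Qed.

(** Labels 4, 5 and 6 are the new vertices. In [spoke_flab], the faces 0, 1 and 2 around the vertex
    0 have five darts each, and face 3 has three. *)
Definition spoke_vlab x := nth 0 [:: 0; 0; 0; 1; 1; 1; 2; 2; 2; 3; 3; 3; 4; 4; 5; 5; 6; 6] x.
Definition spoke_flab x := nth 0 [:: 0; 1; 2; 1; 0; 3; 2; 1; 3; 0; 2; 3; 1; 0; 2; 1; 0; 2] x.

Lemma spoke_node_labels : orbit_labels 18 (nth 0 spoke_node) spoke_vlab 3.
Proof. by []. Qed.

Lemma spoke_face_labels :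
  orbit_labels 18 (fun x => nth 0 spoke_node (nth 0 spoke_edge x)) spoke_flab 5.
Proof. by []. Qed.

Lemma spoke_card_vertex : #|{: vertex spoke_map}| = 7.
Proof. by rewrite card_vertex; apply: (card_porbits_labels spoke_nodeE spoke_node_labels). Qed.

(** Every vertex lies on one of the three subdivided paths from the vertex 0, and any two of these
    bound a common face. The check runs through the at most three darts at each vertex. *)
Lemma spoke_cofacial (v w : vertex spoke_map) : cofacial v w.
Proof.
have [x ->] := origin_ex v; have [y ->] := origin_ex w.
have chk : all (fun x => all (fun y => has (fun i => has (fun j =>
    spoke_flab (iter j (nth 0 spoke_node) y) == spoke_flab (iter i (nth 0 spoke_node) x))
    (iota 0 3)) (iota 0 3)) (iota 0 18)) (iota 0 18) by [].
have /hasP[i _ /hasP[j _]] := all_ord (all_ord chk x) y.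
rewrite -!(iter_ord spoke_nodeE) -(mem_porbit_labels spoke_faceE spoke_face_labels) => ij.
apply/existsP; exists (dart_face (iter i (node spoke_map) x)); apply/andP.
split; apply/existsP; [exists (iter i (node spoke_map) x)|exists (iter j (node spoke_map) y)].
  by rewrite mem_dart_face andbT /= -permX mem_porbit.
by rewrite /= -permX mem_porbit permX.
Qed.

Lemma spoke_longest_deg2_path : longest_deg2_path spoke_map <= 1.
Proof.
apply: longest_deg2_path_le1 => z.
pose N := node spoke_map.
have big (y : dart spoke_map) : uniq [:: y; N y; N (N y)] -> 2 < vdeg (origin y).
  move=> u; apply: card_ge3 u; rewrite /= ?porbit_id //.
    by have := mem_porbit N 1 y; rewrite expg1.
  by have := mem_porbit N 2 y; rewrite expgS expg1 permM.
suff /orP[/big|/big] : uniq [:: z; N z; N (N z)] ||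
    uniq [:: edge spoke_map z; N (edge spoke_map z); N (N (edge spoke_map z))].
- by left.
- by right.
have uval (s : seq 'I_18) : uniq s = uniq (map (@nat_of_ord 18) s).
  by rewrite map_inj_uniq //; apply: val_inj.
rewrite !uval !map_cons /N !spoke_nodeE !spoke_edgeE.
exact: (@all_ord 18 (fun z =>
  let n x := nth 0 spoke_node x in let e := nth 0 spoke_edge z in
  uniq [:: z; n z; n (n z)] || uniq [:: e; n e; n (n e)])).
Qed.

(** Whatever [h] is, a face has at most five darts, and its base face has at least three
    vertices. *)
Lemma spoke_fdeg (h : dart K4 -> dart spoke_map) (f : face spoke_map) :
  subdivision h -> fdeg (val f) - fdeg (base_face h (val f)) <= 2.
Proof.
move=> sub; case: f => f /= /imsetP[z _ ->].
have [y yz] := subdivision_face_surj sub z.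
have zE : porbit (face_perm spoke_map) z = porbit (face_perm spoke_map) (h y).
  by apply/eqP; rewrite eq_sym eq_porbit_mem.
have -> : base_face h (porbit (face_perm spoke_map) z) = porbit (face_perm K4) y.
  by apply/setP=> u; rewrite inE zE (subdivision_face sub).
have := k4_fdeg y; have := fdeg_le_card (porbit (face_perm spoke_map) z).
have := card_porbit_labels spoke_faceE spoke_face_labels z.
by move: (fdeg _) (fdeg _) #|_| => a b d; lia.
Qed.

Theorem theorem8 :
  (forall (R G : cmap) (h : dart R -> dart G),
     plane_graph R -> simple R -> three_connected R -> subdivision h ->
     chi_c G <=
       (\max_(f : face G) (fdeg (val f) - fdeg (base_face h (val f))))
       + longest_deg2_path G + chi_c R)
  /\
  (exists (R G : cmap) (h : dart R -> dart G),
     [/\ plane_graph R, simple R, three_connected R, subdivision h &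
      chi_c G =
        (\max_(f : face G) (fdeg (val f) - fdeg (base_face h (val f))))
        + longest_deg2_path G + chi_c R]).
Proof.
have upper (R G : cmap) (h : dart R -> dart G) :
    plane_graph R -> simple R -> three_connected R -> subdivision h ->
    chi_c G <= (\max_(f : face G) (fdeg (val f) - fdeg (base_face h (val f))))
               + longest_deg2_path G + chi_c R.
  move=> pR sR cR sub; have [p bp] := subdivision_base_dart_map sub.
  exact: chi_c_subdivision_le sub bp pR sR cR.
split=> //; have [h sub] := spoke_subdivision.
have [pR sR cR] := And3 k4_plane k4_simple k4_three_connected.
exists K4, spoke_map, h; split=> //; apply/eqP; rewrite eqn_leq upper //=.
(* Given [upper], equality only takes upper bounds on the right-hand side: 2, 1 and 4 add up to the
   seven pairwise cofacial vertices. *)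
apply: leq_trans (chi_c_ge_card spoke_cofacial); rewrite spoke_card_vertex.
apply: (@leq_add _ _ 3 4); last first.
  by rewrite -k4_card_vertex; apply/chi_c_min/cyclically_colorable_card.
apply: (@leq_add _ _ 2 1); last exact: spoke_longest_deg2_path.
by apply/bigmax_leqP=> f _; apply: spoke_fdeg.
Qed.
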